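(* Let $n \geq 3$. A map $Z : \mathcal{P}_o^n \to \mathcal{K}_o^n$ is an $\mathrm{SL}(n)$ contravariant $L_\infty$ Minkowski valuation if and only if there exist constants $c_1, c_2 \geq 0$ such that $$ZP = c_1 \hat{\Pi}_\infty^+ P +_\infty c_2 \hat{\Pi}_\infty^- P$$ for every $P \in \mathcal{P}_o^n$.
   Context: $\mathcal{K}_o^n$ denotes the set of convex bodies (compact convex sets) in $\mathbb{R}^n$ containing the origin $o$, and $\mathcal{P}_o^n$ the set of convex polytopes in $\mathbb{R}^n$ containing the origin. For a convex body $K$, $h_K(x)=\max\{x\cdot y: y\in K\}$ is its support function. For $K,L\in\mathcal{K}_o^n$, the $L_\infty$ Minkowski sum $K+_\infty L$ is the convex body with support function $h_{K+_\infty L}=\max\{h_K,h_L\}$ (i.e. the convex hull of $K\cup L$). A map $Z:\mathcal{P}_o^n\to\mathcal{K}_o^n$ is an $L_\infty$ Minkowski valuation if $Z(K\cup L)+_\infty Z(K\cap L)=ZK+_\infty ZL$ whenever $K,L,K\cup L,K\cap L\in\mathcal{P}_o^n$. $Z$ is $\mathrm{SL}(n)$ contravariant if $Z(\phi K)=\phi^{-t}ZK$ for all $K$ and all $\phi\in\mathrm{SL}(n)$. For $P\in\mathcal{P}_o^n$, let $\mathcal{N}(P)$ be the set of outer unit normals to the facets ($(n-1)$-dimensional faces) of $P$ and $\mathcal{N}_o(P)\subset\mathcal{N}(P)$ the set of outer unit normals to facets of $P$ that contain the origin. The asymmetric $L_\infty$ projection body is $\hat{\Pi}_\infty^+P=\mathrm{conv}\big(\{o\}\cup\{u/h_P(u):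 u\in\mathcal{N}(P)\setminus\mathcal{N}_o(P)\}\big)$, and $\hat{\Pi}_\infty^-P=-\hat{\Pi}_\infty^+P$. For $c\ge 0$, $cK=\{cx:x\in K\}$. *)

(* Defs.v *)
(* MathComp + MathComp-Analysis, R : realType, points of R^n
   are row vectors 'rV[R]_n; matrices act on them "as on column vectors",
   i.e. phi . x := x *m phi^T. *)
From HB Require Import structures.
From mathcomp Require Import all_boot all_order all_algebra.
From mathcomp Require Import all_classical all_reals all_analysis.
Import numFieldNormedType.Exports.
Set Implicit Arguments. Unset Strict Implicit. Unset Printing Implicit Defensive.
Import Order.TTheory GRing.Theory Num.Theory.
Local Open Scope classical_set_scope.
Local Open Scope ring_scope.

Section Defs.
Variables (R : realType) (n : nat).
Notation vec := 'rV[R]_n.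

Definition dotv (x y : vec) : R := (x *m y^T) 0 0.

Definition conv (S : set vec) : set vec :=
  [set x | exists (k : nat) (w : 'I_k -> R) (p : 'I_k -> vec),
      (forall i, 0 <= w i) /\ \sum_(i < k) w i = 1 /\
      (forall i, S (p i)) /\ x = \sum_(i < k) w i *: p i].

Definition convex_set (K : set vec) : Prop :=
  forall x y (t : R), K x -> K y -> 0 <= t <= 1 -> K ((1 - t) *: x + t *: y).

Definition body_o (K : set vec) : Prop :=
  compact K /\ convex_set K /\ K 0.

Definition polytope_o (P : set vec) : Prop :=
  (exists s : seq vec, P = conv [set x | x \in s]) /\ P 0.

Definition supp (K : set vec) (x : vec) : R := sup [set dotv x y | y in K].

Definition linf_sum (K L : set vec) : set vec := conv (K `|` L).

Definition scale_set (c : R) (K : set vec) : set vec := [set c *: x | x in K].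

(* phi K, phi acting on (column) coordinates *)
Definition lin_img (phi : 'M[R]_n) (K : set vec) : set vec :=
  [set x *m phi^T | x in K].

Definition face (P : set vec) (u : vec) : set vec :=
  [set x | P x /\ dotv x u = supp P u].

(* the set F has dimension (at least) n-1: the differences of points of F
   span a linear subspace of dimension n-1 *)
Definition dim_nm1 (F : set vec) : Prop :=
  exists (k : nat) (a b : 'I_k -> vec),
    (forall i, F (a i) /\ F (b i)) /\
    \rank (\matrix_(i < k) (a i - b i)) = n.-1.

Definition facet_normal (P : set vec) (u : vec) : Prop :=
  dotv u u = 1 /\ dim_nm1 (face P u).

Definition facet_normal_nonorigin (P : set vec) (u : vec) : Prop :=
  facet_normal P u /\ ~ face P u 0.

Definition Pi_inf_plus (P : set vec) : set vec :=
  conv ([set 0] `|` [set (supp P u)^-1 *: u | u in facet_normal_nonorigin P]).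

Definition Pi_inf_minus (P : set vec) : set vec :=
  [set - x | x in Pi_inf_plus P].

Definition linf_valuation (Z : set vec -> set vec) : Prop :=
  forall K L, polytope_o K -> polytope_o L -> polytope_o (K `|` L) ->
    polytope_o (K `&` L) ->
    linf_sum (Z (K `|` L)) (Z (K `&` L)) = linf_sum (Z K) (Z L).

Definition SL_contravariant (Z : set vec -> set vec) : Prop :=
  forall (K : set vec) (phi : 'M[R]_n), polytope_o K -> \det phi = 1 ->
    Z (lin_img phi K) = lin_img (invmx phi)^T (Z K).

End Defs.

(* Main.v *)
(* A facet of P that misses the origin lies in a unique hyperplane a.x = 1, and the points a so
   obtained are the u/h_P(u) of the definition of the projection body.  If P and Q are polytopes
   with convex union, then the duals of the union together with those of the intersection are
   exactly the duals of P together with those of Q; this yields the valuation property.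

   Conversely, let Z be a contravariant valuation.  Transvections show that Z P lies on the normal
   line of any hyperplane that contains P, and halving an (n-1)-simplex forces Z P = {0} there.
   Hence cutting by a hyperplane through o makes Z P the convex hull of the values at the two
   pieces.  For the standard simplex T put K_s = s Z(sT).  Cutting sT across the edge e_i e_j
   preserves the coordinates other than i, j and stretches y_i - y_j by the inverse of the volume
   ratio, so the boundedness of Z forces K_s onto the diagonal, where it cannot depend on s.  Thus
   Z conv(0, W) = [-c2, c1] a for a simplex with dual a.  Finally, finitely many hyperplanes
   through o cut P into pieces of simplices spanned by vertices of P, and only those simplices
   whose dual is a dual of P are needed. *)
Require Import Defs.
From HB Require Import structures.
From mathcomp Require Import all_boot all_order all_algebra.
From mathcomp Require Import all_classical all_reals all_analysis.
From mathcomp Require Import perm ring lra.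
Import numFieldNormedType.Exports.
Import Order.TTheory GRing.Theory Num.Theory.
Local Open Scope classical_set_scope.
Local Open Scope ring_scope.

Set Implicit Arguments.
Unset Strict Implicit.
Unset Printing Implicit Defensive.

(* mathcomp-analysis has its own [convex_set] and [conv]. *)
Local Notation convex_set := Defs.convex_set.
Local Notation conv := Defs.conv.

(** * The inner product, annihilators and spanning sets *)

Section Vectors.
Context {R : realType} {n : nat}.
Implicit Types x y z u v : 'rV[R]_n.

Lemma dotvE x y : dotv x y = \sum_i x 0 i * y 0 i.
Proof. by rewrite /dotv mxE; apply: eq_bigr => i _; rewrite mxE. Qed.

Lemma dotvC x y : dotv x y = dotv y x.
Proof. by rewrite !dotvE; apply: eq_bigr => i _; rewrite mulrC. Qed.

Lemma dotvDl x y z : dotv (x + y) z = dotv x z + dotv y z.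
Proof. by rewrite /dotv mulmxDl mxE. Qed.

Lemma dotvZl (a : R) x z : dotv (a *: x) z = a * dotv x z.
Proof. by rewrite /dotv -scalemxAl mxE. Qed.

Lemma dotvZr (a : R) x z : dotv x (a *: z) = a * dotv x z.
Proof. by rewrite dotvC dotvZl dotvC. Qed.

Lemma dotvDr x y z : dotv x (y + z) = dotv x y + dotv x z.
Proof. by rewrite dotvC dotvDl !(dotvC x). Qed.

Lemma dotvNl x z : dotv (- x) z = - dotv x z.
Proof. by rewrite -scaleN1r dotvZl mulN1r. Qed.

Lemma dotvNr x z : dotv x (- z) = - dotv x z.
Proof. by rewrite dotvC dotvNl dotvC. Qed.

Lemma dotv0l z : dotv 0 z = 0 :> R.
Proof. by rewrite -(scale0r 0) dotvZl mul0r. Qed.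

Lemma dotv0r z : dotv z 0 = 0 :> R.
Proof. by rewrite dotvC dotv0l. Qed.

Lemma dotv_suml (I : Type) (r : seq I) (P : pred I) (F : I -> 'rV[R]_n) z :
  dotv (\sum_(i <- r | P i) F i) z = \sum_(i <- r | P i) dotv (F i) z.
Proof. by rewrite /dotv mulmx_suml summxE. Qed.

Lemma dotv_ge0 x : 0 <= dotv x x.
Proof. by rewrite dotvE; apply: sumr_ge0 => i _; rewrite -expr2 sqr_ge0. Qed.

Lemma dotv_eq0 x : (dotv x x == 0) = (x == 0).
Proof.
apply/eqP/eqP => [|->]; last by rewrite dotv0l.
rewrite dotvE => /eqP; rewrite psumr_eq0; last by move=> i _; rewrite -expr2 sqr_ge0.
move=> /allP x0; apply/rowP => i; rewrite mxE; apply/eqP.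
by have := x0 i (mem_index_enum _); rewrite mulf_eq0 orbb.
Qed.

Lemma dotv_mull m (x : 'rV[R]_m) (M : 'M[R]_(m, n)) y :
  dotv (x *m M) y = dotv x (y *m M^T).
Proof. by rewrite /dotv trmx_mul trmxK mulmxA. Qed.

Lemma dotv_delta x i : dotv x (delta_mx 0 i) = x 0 i.
Proof.
rewrite dotvE (bigD1 i) //= big1 => [|j ji]; rewrite mxE /= ?eqxx ?mulr1 ?addr0//.
by rewrite (negbTE ji) mulr0.
Qed.

Lemma dotv_row_mul m (M : 'M[R]_(m, n)) u i : dotv (row i M) u = (M *m u^T) i 0.
Proof. by rewrite /dotv -row_mul mxE. Qed.

Lemma exists_annihilator m (V : 'M[R]_(m, n)) : (\rank V < n)%N ->
  exists2 u : 'rV[R]_n, u != 0 & V *m u^T = 0.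
Proof.
move=> rV; have : cokermx V != 0 by rewrite -mxrank_eq0 mxrank_coker subn_eq0 -ltnNge.
move=> /eqP K0.
have [j cj] : exists j, col j (cokermx V) != 0.
  apply: contra_notP K0 => /forallNP K0; apply/matrixP => i j.
  have := K0 j; move/negP/negPn/eqP/colP/(_ i); by rewrite !mxE.
exists (col j (cokermx V))^T; first by rewrite -trmx0 (inj_eq trmx_inj).
by rewrite trmxK colE mulmxA mulmx_coker mul0mx.
Qed.

(** Rows are taken from [F] with maximal rank [r]. If [r < n], a vector annihilating them
    annihilates all of [F], since any other point of [F] would raise the rank; if [r = n],
    independent rows among them form [W]. *)
Lemma span_or_annihilated (F : set 'rV[R]_n) :
  (exists2 W : 'M[R]_n, W \in unitmx & forall i, F (row i W)) \/
  (exists2 u : 'rV[R]_n, u != 0 & forall x, F x -> dotv x u = 0).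
Proof.
pose has_rank r := `[< exists k (V : 'M[R]_(k, n)), (forall i, F (row i V)) /\ \rank V = r >].
have ex : exists r, has_rank r.
  exists 0%N; apply/asboolP; exists 0%N, (0 : 'M[R]_(0, n)); split; first by case.
  by rewrite mxrank0.
have bd r : has_rank r -> (r <= n)%N.
  by move=> /asboolP[k [V [_ <-]]]; exact: rank_leq_col.
case: (ex_maxnP ex bd) => r /asboolP[k [V [FV rV]]] rmax.
have [rn|nr] := ltnP r n; [right|left].
  have [u u0 Vu] : exists2 u : 'rV[R]_n, u != 0 & V *m u^T = 0.
    by apply: exists_annihilator; rewrite rV.
  exists u => // x Fx; apply/eqP/negPn/negP => xu.
  have : has_rank (\rank (col_mx V x)).
    apply/asboolP; exists (k + 1)%N, (col_mx V x); split=> // i.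
    rewrite -[i]splitK; case: (fintype.split i) => j /=.
      by rewrite rowKu.
    by rewrite rowKd (_ : row j x = x) // ; apply/rowP => l; rewrite mxE ord1.
  move/rmax; rewrite leqNgt => /negP; apply.
  rewrite -rV -addsmxE ltn_neqAle mxrankS ?addsmxSl // andbT.
  apply/negP => rk.
  have : (x <= V)%MS.
    apply: submx_trans (addsmxSr V x) _.
    by rewrite -(mxrank_leqif_sup (addsmxSl V x)) rk.
  move=> /submxP[D xD]; move: xu; rewrite xD /dotv -mulmxA Vu mulmx0 mxE eqxx.
  by [].
have fV : row_full V by rewrite /row_full rV eqn_leq nr bd //; apply/asboolP; exists k, V.
exists (rowsub (fullrankfun fV) V).
  exact: fullrowsub_unit.
by move=> i; rewrite row_rowsub.
Qed.

Lemma lincomb_row k (w : 'rV[R]_k) (V : 'M[R]_(k, n)) :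
  w *m V = \sum_i w 0 i *: row i V.
Proof. exact: mulmx_sum_row. Qed.

End Vectors.

(** * Convex hulls and polytopes containing the origin *)

Section Convexity.
Context {R : realType} {n : nat}.
Implicit Types (x y z u v : 'rV[R]_n) (S M P K : set 'rV[R]_n).

(** Weights are left unnormalised and their total is factored out, so that partial sums can be
    treated by induction; [x0] serves when the total vanishes. *)
Lemma convex_weighted_sum M x0 (I : Type) (r : seq I) (w : I -> R) (p : I -> 'rV[R]_n) :
  convex_set M -> M x0 -> (forall i, 0 <= w i) -> (forall i, M (p i)) ->
  exists2 q, M q & \sum_(i <- r) w i *: p i = (\sum_(i <- r) w i) *: q.
Proof.
move=> cM Mx0 w0 Mp; elim: r => [|i r [q Mq IH]].
  by exists x0; rewrite // !big_nil scale0r.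
rewrite !big_cons IH; set s := \sum_(j <- r) w j.
have s0 : 0 <= s by apply: sumr_ge0.
have [ws|ws] := eqVneq (w i + s) 0.
  exists x0 => //; have wi := w0 i.
  have -> : w i = 0 by lra.
  have -> : s = 0 by lra.
  by rewrite !scale0r add0r addr0 scale0r.
have ws0 : 0 < w i + s by rewrite lt_neqAle eq_sym ws addr_ge0.
exists ((1 - s / (w i + s)) *: p i + (s / (w i + s)) *: q).
  apply: cM => //; rewrite ler_pdivrMr // mul1r lerDr w0 andbT.
  by rewrite divr_ge0 // ltW.
rewrite scalerDr !scalerA; congr (_ *: _ + _ *: _); field; exact: ws.
Qed.

Lemma conv_convex S : convex_set (conv S).
Proof.
move=> _ _ t [k [w [p [w0 [w1 [Sp ->]]]]]] [l [w' [p' [w'0 [w'1 [Sp' ->]]]]]] /andP[t0 t1].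
exists (k + l)%N,
  (fun i => match fintype.split i with inl j => (1 - t) * w j | inr j => t * w' j end),
  (fun i => match fintype.split i with inl j => p j | inr j => p' j end).
split; [|split; [|split]].
- by move=> i; case: fintype.split => j; rewrite mulr_ge0 ?subr_ge0.
- rewrite big_split_ord /=.
  under eq_bigr do rewrite (unsplitK (inl _)).
  under [X in _ + X]eq_bigr do rewrite (unsplitK (inr _)).
  by rewrite -!mulr_sumr w1 w'1 !mulr1 subrK.
- by move=> i; case: fintype.split.
- rewrite big_split_ord /=.
  under [in RHS]eq_bigr do rewrite (unsplitK (inl _)) -scalerA.
  under [X in _ = _ + X]eq_bigr do rewrite (unsplitK (inr _)) -scalerA.
  by rewrite -!scaler_sumr.
Qed.

Lemma sub_conv S : S `<=` conv S.
Proof.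
move=> x Sx; exists 1%N, (fun=> 1), (fun=> x).
by split=> //; split; [|split] => //; rewrite big_ord1 ?scale1r.
Qed.

Lemma conv_min S M : convex_set M -> S `<=` M -> conv S `<=` M.
Proof.
move=> cM SM x [k [w [p [w0 [w1 [Sp ->]]]]]].
case: k w p w0 w1 Sp => [|k] w p w0 w1 Sp.
  by move: w1; rewrite big_ord0 => /esym/eqP; rewrite oner_eq0.
have [q Mq ->] := convex_weighted_sum (index_enum _) cM (SM _ (Sp ord0)) w0 (fun i => SM _ (Sp i)).
by rewrite w1 scale1r.
Qed.

Lemma conv_sub S S' : S `<=` S' -> conv S `<=` conv S'.
Proof.
by move=> SS'; apply: conv_min; [exact: conv_convex|move=> x /SS'; exact: sub_conv].
Qed.

Lemma conv_id M : convex_set M -> conv M = M.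
Proof. by move=> cM; rewrite eqEsubset; split; [exact: conv_min|exact: sub_conv]. Qed.

Lemma convex_setI M M' : convex_set M -> convex_set M' -> convex_set (M `&` M').
Proof. by move=> cM cM' x y t [? ?] [? ?] ?; split; [exact: cM|exact: cM']. Qed.

Lemma convex_preimage m (A : 'M[R]_(n, m)) (M : set 'rV[R]_m) :
  convex_set M -> convex_set [set x | M (x *m A)].
Proof. by move=> cM x y t /= Mx My t01; rewrite mulmxDl -!scalemxAl; exact: cM. Qed.

(* conv(0, rows of V): the missing weight [1 - \sum_i w 0 i] sits at the origin. *)
Definition hull0 k (V : 'M[R]_(k, n)) : set 'rV[R]_n :=
  [set x | exists2 w : 'rV[R]_k, (forall i, 0 <= w 0 i) /\ \sum_i w 0 i <= 1 & x = w *m V].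

Lemma hull0_convex k (V : 'M[R]_(k, n)) : convex_set (hull0 V).
Proof.
move=> _ _ t [w [w0 w1] ->] [w' [w'0 w'1] ->] /andP[t0 t1].
exists ((1 - t) *: w + t *: w'); last by rewrite mulmxDl -!scalemxAl.
split=> [i|]; first by rewrite !mxE addr_ge0 // mulr_ge0 // subr_ge0.
under eq_bigr do rewrite !mxE.
rewrite big_split /= -!mulr_sumr.
have h1 : (1 - t) * (\sum_i w 0 i) <= 1 - t by rewrite ler_piMr ?subr_ge0.
have h2 : t * (\sum_i w' 0 i) <= t by rewrite ler_piMr.
lra.
Qed.

Lemma hull0_0 k (V : 'M[R]_(k, n)) : hull0 V 0.
Proof.
exists 0; last by rewrite mul0mx.
by split=> [i|]; rewrite ?mxE // big1 // => i _; rewrite mxE.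
Qed.

Lemma hull0_row k (V : 'M[R]_(k, n)) i : hull0 V (row i V).
Proof.
exists (delta_mx 0 i); last by rewrite rowE.
split=> [j|]; first by rewrite mxE ler0n.
by rewrite (bigD1 i) //= big1 ?mxE ?eqxx ?addr0 // => j /negbTE; rewrite mxE eqxx => ->.
Qed.

Lemma hull0_min k (V : 'M[R]_(k, n)) M :
  convex_set M -> M 0 -> (forall i, M (row i V)) -> hull0 V `<=` M.
Proof.
move=> cM M0 MV _ [w [w0 w1] ->]; rewrite lincomb_row.
have [q Mq ->] := convex_weighted_sum (index_enum _) cM M0 w0 MV.
have s0 : 0 <= \sum_i w 0 i by apply: sumr_ge0.
rewrite -[_ *: q]add0r -(scaler0 _ (1 - \sum_i w 0 i)).
by apply: cM => //; rewrite s0.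
Qed.

Lemma hull0_sub k l (V : 'M[R]_(k, n)) (W : 'M[R]_(l, n)) :
  (forall i, hull0 W (row i V)) -> hull0 V `<=` hull0 W.
Proof. by apply: hull0_min; [exact: hull0_convex|exact: hull0_0]. Qed.

Lemma hull0_polytope k (V : 'M[R]_(k, n)) : polytope_o (hull0 V).
Proof.
split; last exact: hull0_0.
exists (0 :: [seq row i V | i <- enum 'I_k]).
rewrite eqEsubset; split.
  apply: hull0_min; first exact: conv_convex.
    by apply: sub_conv => /=; rewrite mem_head.
  move=> i; apply: sub_conv => /=; rewrite inE; apply/orP; right.
  by apply/mapP; exists i; rewrite ?mem_enum.
apply: conv_min; first exact: hull0_convex.
move=> x /=; rewrite inE => /orP[/eqP->|/mapP[i _ ->]]; [exact: hull0_0|exact: hull0_row].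
Qed.

(** The generating points become the rows of [V]; the extra vertex o changes nothing because it lies
    in [P]. In this form linear maps act by matrix products and weights are row vectors. *)
Lemma polytope_hull0 P : polytope_o P -> exists k (V : 'M[R]_(k, n)), P = hull0 V.
Proof.
move=> [[s Ps] P0]; exists (size s), (\matrix_i nth 0 s i).
rewrite Ps eqEsubset; split.
  apply: conv_min; first exact: hull0_convex.
  move=> x /= xs; have xi := xs; rewrite -index_mem in xi.
  have <- : row (Ordinal xi) (\matrix_i nth 0 s i) = x by rewrite rowK /= nth_index.
  exact: hull0_row.
apply: hull0_min; first exact: conv_convex.
  by rewrite -Ps.
by move=> i; apply: sub_conv; rewrite /= rowK mem_nth.
Qed.

Lemma polytope_convex P : polytope_o P -> convex_set P.
Proof. by move=> /polytope_hull0[k [V ->]]; exact: hull0_convex. Qed.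

Lemma sum_by_sign (T : zmodType) k (a : 'I_k -> R) (F : 'I_k -> T) :
  \sum_i F i = \sum_(i | 0 < a i) F i + \sum_(i | a i < 0) F i + \sum_(i | a i == 0) F i.
Proof.
rewrite (bigID (fun i => 0 < a i)) /= -addrA; congr (_ + _).
rewrite (bigID (fun i => a i < 0)) /=; congr (_ + _); apply: eq_bigl => i;
by case: (ltgtP (a i) 0).
Qed.

(** The weight of the negative indices is paired with the fraction [be / al] of the positive weight,
    each pair receiving a share proportional to [w i * w j]. The combination attached to a pair has
    [a]-value zero, so no negative index is left over. *)
Lemma transport_sum (T : lmodType R) k (a w : 'I_k -> R) (p : 'I_k -> T)
    (al := \sum_(i | 0 < a i) w i * a i) (be := \sum_(j | a j < 0) w j * - a j) :
  al != 0 ->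
  \sum_(i | 0 < a i) (w i * (1 - be / al)) *: p i + \sum_(i | a i == 0) w i *: p i +
  \sum_(i | 0 < a i) \sum_(j | a j < 0) (w i * w j / al) *: (- a j *: p i + a i *: p j) =
  \sum_i w i *: p i.
Proof.
move=> al0.
have -> : \sum_(i | 0 < a i) \sum_(j | a j < 0) (w i * w j / al) *: (- a j *: p i + a i *: p j) =
    \sum_(i | 0 < a i) (w i * (be / al)) *: p i + \sum_(j | a j < 0) w j *: p j.
  under eq_bigr do under eq_bigr do rewrite scalerDr !scalerA.
  under eq_bigr do rewrite big_split /=.
  rewrite big_split /=; congr (_ + _).
    apply: eq_bigr => i _; rewrite -scaler_suml; congr (_ *: _).
    by rewrite /be mulr_suml mulr_sumr; apply: eq_bigr => j _; ring.
  rewrite exchange_big /=; apply: eq_bigr => j _; rewrite -scaler_suml; congr (_ *: _).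
  transitivity (w j / al * al); last by field.
  by rewrite {2}/al mulr_sumr; apply: eq_bigr => i _; ring.
rewrite [RHS](sum_by_sign a) addrACA -big_split /= -[RHS]addrA [X in _ = _ + X]addrC.
congr (_ + _); apply: eq_bigr => i _; rewrite -scalerDl; congr (_ *: _); ring.
Qed.

(* Transport along the crossing points: a positive vertex and a negative one
   are joined at the point where their segment meets the hyperplane. *)
Lemma polytope_halfspace P u :
  polytope_o P -> polytope_o (P `&` [set x | 0 <= dotv x u]).
Proof.
move=> /polytope_hull0[k [V ->]].
pose a i := dotv (row i V) u.
pose crossing i j : 'rV[R]_n := (a i - a j)^-1 *: (- a j *: row i V + a i *: row j V).
(* Indices that contribute no vertex are sent to the origin, which belongs to both sides anyway. *)
pose vtx (e : 'I_k + 'I_k * 'I_k) : 'rV[R]_n :=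
  match e with
  | inl i => if 0 <= a i then row i V else 0
  | inr (i, j) => if (0 < a i) && (a j < 0) then crossing i j else 0
  end.
pose W := \matrix_(e < #|{: 'I_k + 'I_k * 'I_k}|) vtx (enum_val e).
suff -> : hull0 V `&` [set x | 0 <= dotv x u] = hull0 W by exact: hull0_polytope.
have cvx_half : convex_set [set x | 0 <= dotv x u].
  move=> x y t /= x0 y0 /andP[t0 t1]; rewrite dotvDl !dotvZl.
  by rewrite addr_ge0 // mulr_ge0 // subr_ge0.
rewrite eqEsubset; split; last first.
  apply: hull0_min.
  - by apply: convex_setI => //; exact: hull0_convex.
  - by split=> /=; [exact: hull0_0|rewrite dotv0l].
  move=> e; rewrite rowK; case: (enum_val e) => [i|[i j]] /=.
    case: ifP => ai; last by split=> /=; [exact: hull0_0|rewrite dotv0l].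
    by split=> //; exact: hull0_row.
  case: ifP => [/andP[ai aj]|_]; last by split=> /=; [exact: hull0_0|rewrite dotv0l].
  have aij : 0 < a i - a j by lra.
  split=> /=; last first.
    by rewrite dotvZl dotvDl !dotvZl -/(a i) -/(a j) mulNr [a i * _]mulrC addNr mulr0.
  have -> : crossing i j = (1 - a i / (a i - a j)) *: row i V + (a i / (a i - a j)) *: row j V.
    rewrite /crossing scalerDr !scalerA; congr (_ *: _ + _ *: _); field; lra.
  apply: hull0_convex; try exact: hull0_row.
  rewrite ler_pdivrMr // mul1r; apply/andP; split; last by lra.
  by rewrite divr_ge0 // ltW.
move=> _ [[w [w0 w1] ->] /= xu].
have cW : convex_set (hull0 W) by exact: hull0_convex.
have Wv e : hull0 W (vtx e).
  have <- : row (enum_rank e) W = vtx e by rewrite rowK enum_rankK.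
  exact: hull0_row.
pose al := \sum_(i | 0 < a i) w 0 i * a i.
pose be := \sum_(j | a j < 0) w 0 j * - a j.
have be0 : 0 <= be by apply: sumr_ge0 => j aj; rewrite mulr_ge0 // oppr_ge0 ltW.
have xab : dotv (w *m V) u = al - be.
  rewrite lincomb_row dotv_suml /al /be (bigID (fun i => 0 < a i)) /=; congr (_ + _).
    by apply: eq_bigr => i _; rewrite dotvZl.
  rewrite -sumrN (bigID (fun i => a i < 0)) /= [X in _ + X]big1 ?addr0.
    rewrite (eq_bigl (fun i => a i < 0)); last first.
      by move=> i /=; case: (ltgtP (a i) 0).
    by apply: eq_bigr => i _; rewrite dotvZl -/(a i); ring.
  move=> i; rewrite -!leNgt => /andP[ai0 ai1]; rewrite dotvZl -/(a i).
  have -> : a i = 0 by apply/eqP; rewrite eq_le ai0 ai1.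
  by rewrite mulr0.
have albe : be <= al by rewrite xab in xu; lra.
(* If [al = 0] then [be = 0], so the negative rows carry no weight and nothing has to be
   transported. *)
have [al0|al0] := eqVneq al 0.
  have be00 : be = 0 by lra.
  have wneg j : a j < 0 -> w 0 j = 0.
    move=> aj; have : be == 0 by rewrite be00.
    rewrite psumr_eq0; last by move=> i ai; rewrite mulr_ge0 // oppr_ge0 ltW.
    move=> /allP/(_ j (mem_index_enum _)); rewrite aj /= mulf_eq0 oppr_eq0 (lt_eqF aj) orbF.
    by move/eqP.
  rewrite lincomb_row.
  have -> : \sum_i w 0 i *: row i V = \sum_i w 0 i *: vtx (inl i).
    apply: eq_bigr => i _ /=; case: ifP => // /negbT; rewrite -ltNge => /wneg ->.
    by rewrite !scale0r.
  have [q Wq ->] := convex_weighted_sum (index_enum _) cW (hull0_0 W)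
    w0 (fun i => Wv (inl i)).
  rewrite -[_ *: q]add0r -(scaler0 _ (1 - \sum_i w 0 i)).
  apply: hull0_convex => //; [exact: hull0_0|].
  by rewrite w1 andbT; apply: sumr_ge0.
have al_gt0 : 0 < al by rewrite lt_neqAle eq_sym al0; lra.
pose w' (e : 'I_k + 'I_k * 'I_k) : R :=
  match e with
  | inl i => if 0 < a i then w 0 i * (1 - be / al) else if a i < 0 then 0 else w 0 i
  | inr (i, j) => if (0 < a i) && (a j < 0) then
      w 0 i * w 0 j * (a i - a j) / al else 0
  end.
have w'0 e : 0 <= w' e.
  case: e => [i|[i j]] /=.
    case: ifP => _; last by case: ifP.
    by rewrite mulr_ge0 // subr_ge0 ler_pdivrMr // mul1r.
  case: ifP => // /andP[ai aj].
  by apply: divr_ge0; [rewrite !mulr_ge0 // subr_ge0 ltW // (lt_trans aj)|exact: ltW].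
(* Stated for any module: constant 1 in [R^o] yields the total weight, the rows of [V] yield the
   point. The factor [a i - a j] in [w'] cancels the normalisation of [crossing]. *)
have sum_vtx (T : lmodType R) (p : 'I_k -> T) (q : 'I_k + 'I_k * 'I_k -> T) :
    (forall i, 0 <= a i -> q (inl i) = p i) ->
    (forall i j, 0 < a i -> a j < 0 ->
       q (inr (i, j)) = (a i - a j)^-1 *: (- a j *: p i + a i *: p j)) ->
    \sum_e w' e *: q e = \sum_i w 0 i *: p i.
  move=> ql qr; rewrite big_sumType /= -(@transport_sum T k a (w 0) p al0); congr (_ + _).
    rewrite (sum_by_sign a) /= [X in _ + X + _]big1 ?addr0.
      congr (_ + _); apply: eq_bigr => i ai.
        by rewrite ai ql // ltW.
      by rewrite (eqP ai) ltxx ql // (eqP ai).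
    by move=> i ai; rewrite (lt_gtF ai) ai scale0r.
  rewrite pair_big_dep /= [LHS](bigID (fun e => (0 < a e.1) && (a e.2 < 0))) /=.
  rewrite [X in _ + X]big1 ?addr0; last by move=> [i j] /= /negbTE ->; rewrite scale0r.
  apply: eq_bigr => -[i j] /= /andP[ai aj]; rewrite ai aj qr // !scalerA; congr (_ *: _).
  by rewrite mulrAC mulfK //; lra.
have sumw' : \sum_e w' e = \sum_i w 0 i.
  have := sum_vtx R^o (fun=> 1) (fun=> 1) (fun _ _ => erefl).
  rewrite /GRing.scale /=; under eq_bigr do rewrite mulr1; under [in RHS]eq_bigr do rewrite mulr1.
  by apply=> i j ai aj; rewrite /= !mulr1 addrC mulVf //; lra.
have sumx : \sum_e w' e *: vtx e = w *m V.
  rewrite lincomb_row; apply: sum_vtx => [i|i j] /= ai; first by rewrite ai.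
  by move=> aj; rewrite ai aj.
rewrite -sumx.
have [q Wq ->] := convex_weighted_sum (index_enum _) cW (hull0_0 W) w'0 Wv.
rewrite sumw' -[_ *: q]add0r -(scaler0 _ (1 - \sum_i w 0 i)).
apply: hull0_convex => //; [exact: hull0_0|].
by rewrite w1 andbT; apply: sumr_ge0.
Qed.

End Convexity.

(** * Compactness of polytopes and linear functionals on compact sets *)

Section Topology.
Context {R : realType} {n : nat}.
Implicit Types (x y z u v : 'rV[R]_n) (P Q K : set 'rV[R]_n).

Lemma continuous_sum (T : topologicalType) (V : normedModType R) (I : Type) (r : seq I)
    (f : I -> T -> V) :
  (forall i, continuous (f i)) -> continuous (fun p => \sum_(i <- r) f i p).
Proof.
move=> cf; elim: r => [|i r IH].
  rewrite (_ : (fun p => _) = cst 0); first by move=> p; exact: cvg_cst.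
  by apply/funext => p; rewrite big_nil.
rewrite (_ : (fun p => _) = (fun p => f i p + \sum_(j <- r) f j p)).
  by move=> p; apply: cvgD; [exact: cf|exact: IH].
by apply/funext => p; rewrite big_cons.
Qed.

Lemma mulmxr_continuous k (V : 'M[R]_(k, n)) : continuous (fun w : 'rV[R]_k => w *m V).
Proof.
have -> : (fun w : 'rV[R]_k => w *m V) = (fun w => \sum_i w 0 i *: row i V).
  by apply/funext => w; rewrite lincomb_row.
apply: continuous_sum => i w; have h := @coord_continuous R 1 k 0 i w.
exact: (cvgZr_tmp (a := row i V) h).
Qed.

(** The hull is the linear image of the set of admissible weights, a closed part of a cube. *)
Lemma hull0_compact k (V : 'M[R]_(k, n)) : compact (hull0 V).
Proof.
pose D := [set w : 'rV[R]_k | (forall i, 0 <= w 0 i <= 1)].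
have cD : compact D.
  have := @rV_compact R k (fun=> `[0, 1]%classic) (fun=> @segment_compact R 0 1).
  by congr compact; apply/seteqP; split=> w /= h i; have := h i; rewrite in_itv.
pose D1 := D `&` [set w : 'rV[R]_k | \sum_i w 0 i <= 1].
have cD1 : compact D1.
  apply: compact_closedI => //.
  have -> : [set w : 'rV[R]_k | \sum_i w 0 i <= 1] =
      (fun w : 'rV[R]_k => \sum_i w 0 i) @^-1` [set r | r <= 1] by [].
  apply: preimage_closed; last exact: closed_le.
  move=> w _; move: w; apply: continuous_sum => i; exact: coord_continuous.
have -> : hull0 V = (fun w : 'rV[R]_k => w *m V) @` D1.
  apply/seteqP; split=> [_ [w [w0 w1] ->]|_ [w [Dw w1] <-]].
    exists w => //; split=> // i; rewrite w0 /=; apply: le_trans w1.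
    by rewrite (bigD1 i) //= lerDl sumr_ge0.
  by exists w => //; split=> // i; case/andP: (Dw i).
apply: continuous_compact => //.
by apply: continuous_subspaceT; exact: mulmxr_continuous.
Qed.

Lemma polytope_compact P : polytope_o P -> compact P.
Proof. by move=> /polytope_hull0[k [V ->]]; exact: hull0_compact. Qed.

Lemma dotv_continuous u : continuous (fun x => dotv x u).
Proof.
have -> : (fun x => dotv x u) = (fun x => \sum_i x 0 i * u 0 i).
  by apply/funext => x; rewrite dotvE.
apply: continuous_sum => i x; have h := @coord_continuous R 1 n 0 i x.
exact: (cvgMr_tmp (b := u 0 i) h).
Qed.

Lemma compact_dotv_max K u : compact K -> K !=set0 ->
  exists2 c, K c & forall x, K x -> dotv x u <= dotv c u.
Proof.
move=> cK K0; have [|c] := @EVT_max_rV R n (fun x => dotv x u) K K0 cK.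
  by apply: continuous_subspaceT; exact: dotv_continuous.
by rewrite inE => Kc cmax; exists c => // x Kx; apply: cmax; rewrite inE.
Qed.

Lemma compact_dotv_bounded K u : compact K ->
  exists b : R, forall x, K x -> `|dotv x u| <= b.
Proof.
move=> cK; have [K0|] := pselect (K !=set0); last first.
  by move=> /set0P/negP/negPn/eqP ->; exists 0.
have [c Kc cmax] := compact_dotv_max u cK K0.
have [d Kd dmax] := compact_dotv_max (- u) cK K0.
exists (Num.max (dotv c u) (dotv d (- u))) => x Kx.
rewrite ler_norml lerNl !le_max cmax // andbT; apply/orP; right.
by rewrite -dotvNr dmax.
Qed.

Lemma compact_segment_limit K x y : compact K ->
  (forall t : R, 0 < t <= 1 -> K ((1 - t) *: x + t *: y)) -> K x.
Proof.
move=> cK Kt; have clK : closed K by apply: compact_closed => //; exact: norm_hausdorff.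
have cvgx : ((1 - t) *: x + t *: y) @[t --> 0^'+] --> x.
  have {2}-> : x = (1 - 0) *: x + 0 *: y by rewrite subr0 scale1r scale0r addr0.
  apply: cvg_at_right_filter; apply: cvgD; apply: cvgZr_tmp.
    by apply: cvgB; [exact: cvg_cst|exact: cvg_id].
  exact: cvg_id.
apply: (closed_cvg _ clK _ _ cvgx).
near=> t; apply: Kt; apply/andP; split; first by near: t; exact: nbhs_right_gt.
by near: t; exact: nbhs_right_le.
Unshelve. all: by end_near. Qed.

End Topology.

(** * Duals of the facets that miss the origin *)

Section FacetDuals.
Context {R : realType} {n : nat}.
Implicit Types (x y z u v a : 'rV[R]_n) (P Q K : set 'rV[R]_n).

(* The hyperplanes [a . x = 1] spanned by a facet of [P]: by [Pi_inf_plus_duals] these [a]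
   are the points [u / h_P(u)], [u] the normal of a facet that misses the origin. *)
Definition facet_duals P : set 'rV[R]_n :=
  [set a | (forall x, P x -> dotv x a <= 1) /\
     exists2 W : 'M[R]_n, W \in unitmx & forall i, P (row i W) /\ dotv (row i W) a = 1].

(** Let [s] be the last parameter at which the segment from [x] to [y] is in [P]. Beyond [s] the
    segment can only be in [Q], and closedness of both sets puts the point at [s] in the
    intersection. *)
Lemma polytope_union_cross P Q x y :
  polytope_o P -> polytope_o Q -> convex_set (P `|` Q) -> P x -> Q y ->
  exists t : R, 0 <= t <= 1 /\ (P `&` Q) ((1 - t) *: x + t *: y).
Proof.
move=> pP pQ cPQ Px Qy; pose g (t : R) := (1 - t) *: x + t *: y.
have g_comb (s a b : R) : g ((1 - s) * a + s * b) = (1 - s) *: g a + s *: g b.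
  rewrite /g !scalerDr !scalerA addrACA -!scalerDl; congr (_ *: _ + _ *: _); ring.
have g0 : g 0 = x by rewrite /g subr0 scale1r scale0r addr0.
have g1 : g 1 = y by rewrite /g subrr scale0r scale1r add0r.
have PQg t : 0 <= t <= 1 -> (P `|` Q) (g t).
  by move=> t01; apply: cPQ => //; [left|right].
pose A := [set t : R | 0 <= t <= 1 /\ P (g t)].
have A0 : A 0 by split; rewrite ?lexx ?ler01 // g0.
have supA : has_sup A by split; [exists 0|exists 1 => t [/andP[]]].
pose s := sup A.
have s0 : 0 <= s by apply: ub_le_sup => //; case: supA.
have s1 : s <= 1 by apply: ge_sup => [|t [/andP[]]] //; exists 0.
have Pbelow t : 0 <= t -> t < s -> P (g t).
  move=> t0 ts; have [t' [/andP[t'0 t'1] Pt'] tt'] := sup_gt supA.1 ts.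
  have t'p : 0 < t' by apply: le_lt_trans t0 tt'.
  have -> : t = (1 - t / t') * 0 + (t / t') * t' by rewrite mulr0 add0r divfK // gt_eqF.
  rewrite g_comb; apply: polytope_convex => //; first by rewrite g0.
  by rewrite divr_ge0 ?ler_pdivrMr // ?mul1r ltW.
have Ps : P (g s).
  have [->|sn0] := eqVneq s 0; first by rewrite g0.
  apply: (@compact_segment_limit _ _ _ _ x (polytope_compact pP)) => t /andP[t0 t1].
  rewrite -g0 -g_comb mulr0 addr0; apply: Pbelow; first by rewrite mulr_ge0 // subr_ge0.
  by rewrite gtr_pMl ?lt_neqAle ?(eq_sym 0) ?sn0 //; lra.
exists s; split; first by rewrite s0.
split=> //; rewrite -/(g s).
have [->|sn1] := eqVneq s 1; first by rewrite g1.
apply: (@compact_segment_limit _ _ _ _ y (polytope_compact pQ)) => t /andP[t0 t1].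
rewrite -g1 -g_comb; set r := _ + _.
have sr : s < r.
  have : 0 < t * (1 - s) by rewrite mulr_gt0 // subr_gt0 lt_neqAle sn1.
  rewrite /r; lra.
have r1 : r <= 1.
  have : 0 <= (1 - t) * (1 - s) by rewrite mulr_ge0 // subr_ge0.
  rewrite /r; lra.
have r01 : 0 <= r <= 1 by rewrite r1 (le_trans s0) // ltW.
have [Pr|//] := PQg r r01.
have : r <= s by apply: ub_le_sup; [case: supA|split].
by rewrite leNgt sr.
Qed.

Lemma facet_dualsU P Q :
  polytope_o P -> polytope_o Q -> convex_set (P `|` Q) ->
  facet_duals (P `|` Q) `|` facet_duals (P `&` Q) = facet_duals P `|` facet_duals Q.
Proof.
(* A segment of [P `|` Q] that leaves [P] continues in [Q], so [Q] contains the exit point. *)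
have capP P' Q' a : polytope_o P' -> polytope_o Q' -> convex_set (P' `|` Q') ->
    facet_duals P' a -> facet_duals (P' `|` Q') a \/ facet_duals (P' `&` Q') a.
  move=> pP pQ cPQ [Pa [W uW PW]].
  have [Qa|] := pselect (forall y, Q' y -> dotv y a <= 1).
    left; split=> [x [/Pa//|/Qa//]|]; exists W => // i.
    by have [? ?] := PW i; split=> //; left.
  move=> /existsNP[y /not_implyP[Qy /negP]]; rewrite -ltNge => ya; right.
  split=> [x [Px _]|]; first exact: Pa.
  exists W => // i; have [Pi ai] := PW i; split=> //; split=> //.
  apply: (@compact_segment_limit _ _ _ _ y (polytope_compact pQ)) => t /andP[t0 t1].
  have : (P' `|` Q') ((1 - t) *: row i W + t *: y).
    by apply: cPQ; [left|right|rewrite ltW].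
  case=> // /Pa; rewrite dotvDl !dotvZl ai => h.
  have : 0 < t * (dotv y a - 1) by rewrite mulr_gt0 // subr_gt0.
  lra.
move=> pP pQ cPQ; rewrite eqEsubset; split=> a; last first.
  case=> Fa; first by have := capP _ _ _ pP pQ cPQ Fa.
  by have := capP _ _ _ pQ pP; rewrite setUC setIC => /(_ _ cPQ Fa).
case=> [[PQa [W uW PQW]]|[PQa [W uW PQW]]].
  (* If [a] is a dual of neither set, the points of [P] and of [Q] on the hyperplane of [a] lie in
     some [u]-orthogonal and some [v]-orthogonal subspace respectively. *)
  have face_cases (K : set 'rV[R]_n) : (forall x, K x -> dotv x a <= 1) ->
      facet_duals K a \/ exists2 u, u != 0 & forall x, K x -> dotv x a = 1 -> dotv x u = 0.
    move=> Ka; have [[V uV KV]|[u u0 Ku]] := span_or_annihilated (K `&` [set x | dotv x a = 1]).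
      by left; split=> //; exists V.
    by right; exists u => // x Kx xa; apply: Ku.
  have [|[u u0 Pu]] := face_cases P (fun x Px => PQa x (or_introl Px)); first by left.
  have [|[v v0 Qv]] := face_cases Q (fun x Qx => PQa x (or_intror Qx)); first by right.
  have off (w : 'rV[R]_n) : w != 0 -> exists i, dotv (row i W) w != 0.
    move=> w0; apply: contrapT => /forallNP h.
    have : W *m w^T = 0.
      by apply/colP => i; rewrite [RHS]mxE -dotv_row_mul; have /negP/negPn/eqP := h i.
    move/(congr1 (mulmx (invmx W))); rewrite mulmxA mulVmx // mul1mx mulmx0 => /(congr1 trmx).
    by rewrite trmxK trmx0; exact/eqP.
  have [i iu] := off _ u0; have [j jv] := off _ v0.
  have [PQi ia] := PQW i; have [PQj ja] := PQW j.
  have iv : dotv (row i W) v = 0.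
    by apply: Qv => //; case: PQi => // Pi; move: iu; rewrite Pu ?eqxx.
  have ju : dotv (row j W) u = 0.
    by apply: Pu => //; case: PQj => // Qj; move: jv; rewrite Qv ?eqxx.
  (* Row [i] is off the first subspace, hence in [Q] and on the second; row [j] is the mirror case.
     Their midpoint is off both, although it belongs to the union. *)
  pose m := (1 - 2^-1) *: row i W + 2^-1 *: row j W.
  have PQm : (P `|` Q) m by apply: cPQ => //; apply/andP; split; lra.
  have ma : dotv m a = 1 by rewrite /m dotvDl !dotvZl ia ja; lra.
  have mu : dotv m u != 0 by rewrite /m dotvDl !dotvZl ju mulr0 addr0 mulf_neq0 //; lra.
  have mv : dotv m v != 0 by rewrite /m dotvDl !dotvZl iv mulr0 add0r mulf_neq0 //; lra.
  by case: PQm => [/Pu|/Qv] /(_ ma) h; rewrite h eqxx in mu mv.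
have [Pa|] := pselect (forall x, P x -> dotv x a <= 1).
  by left; split=> //; exists W => // i; have [[]] := PQW i.
move=> /existsNP[x /not_implyP[Px /negP]]; rewrite -ltNge => xa.
have [Qa|] := pselect (forall x, Q x -> dotv x a <= 1).
  by right; split=> //; exists W => // i; have [[]] := PQW i.
move=> /existsNP[y /not_implyP[Qy /negP]]; rewrite -ltNge => ya.
(* Both ends exceed 1 under [a], hence so does the crossing point, which lies in the
   intersection. *)
have [t [/andP[t0 t1] PQt]] := polytope_union_cross pP pQ cPQ Px Qy.
have := PQa _ PQt; rewrite dotvDl !dotvZl.
have [->|tn0] := eqVneq t 0; first by rewrite subr0 mul1r mul0r addr0 leNgt xa.
have : 0 < t * (dotv y a - 1) by rewrite mulr_gt0 ?subr_gt0 // lt_neqAle eq_sym tn0.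
have : 0 <= (1 - t) * (dotv x a - 1) by rewrite mulr_ge0 // subr_ge0 // ltW.
lra.
Qed.

Lemma facet_duals_image P (A : 'M[R]_n) : A \in unitmx ->
  facet_duals [set x *m A | x in P] = [set a | facet_duals P (a *m A^T)].
Proof.
move=> uA; apply/seteqP; split=> a [Pa [W uW PW]].
  split=> [x Px|]; first by rewrite -dotv_mull; apply: Pa; exists x.
  exists (W *m invmx A); first by rewrite unitmx_mul uW unitmx_inv.
  move=> i; have [[x Px xW] Wa] := PW i.
  have -> : row i (W *m invmx A) = x by rewrite row_mul -xW -mulmxA mulmxV // mulmx1.
  by split=> //; rewrite -dotv_mull xW.
split=> [_ [x Px <-]|]; first by rewrite dotv_mull; exact: Pa.
exists (W *m A); first by rewrite unitmx_mul uW.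
move=> i; have [Pi ia] := PW i; split; first by exists (row i W); rewrite // row_mul.
by rewrite row_mul dotv_mull.
Qed.

Lemma supp_attained P u c : P c -> (forall x, P x -> dotv x u <= dotv c u) ->
  supp P u = dotv c u.
Proof.
move=> Pc cmax; apply/eqP; rewrite eq_le; apply/andP; split.
  by apply: ge_sup => [|_ [x Px <-]]; [exists (dotv u c); exists c|rewrite dotvC cmax].
rewrite [dotv c u]dotvC; apply: ub_le_sup; last by exists c.
by exists (dotv u c) => _ [x Px <-]; rewrite !(dotvC u) cmax.
Qed.

(** Since the hyperplane of such a facet misses the origin, a facet of dimension n - 1 amounts to n
    linearly independent vectors in it; dividing [u] by [h_P(u)] normalises the equation to
    [a . x = 1]. *)
Lemma Pi_inf_plus_duals P : (0 < n)%N -> polytope_o P ->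
  [set (supp P u)^-1 *: u | u in facet_normal_nonorigin P] = facet_duals P.
Proof.
move=> n0 pP; have P0 : P 0 by case: pP.
apply/seteqP; split=> [_ [u [[u1 [k [p [q [pqF rk]]]]] nF0] <-]|a [Pa [W uW PW]]].
  have [c Pc cmax] := compact_dotv_max u (polytope_compact pP) (ex_intro _ 0 P0).
  have hE := supp_attained Pc cmax; set h := supp P u in hE *.
  have hn0 : h != 0 by apply/eqP => h0; apply: nF0; split; rewrite // dotv0l -/h h0.
  have h0 : 0 < h.
    by rewrite lt_neqAle eq_sym hn0 /=; have := cmax _ P0; rewrite dotv0l hE.
  split=> [x Px|].
    by rewrite dotvZr mulrC ler_pdivrMr // mul1r hE cmax.
  have [[W uW FW]|[v v0 Fv]] := span_or_annihilated (face P u).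
    exists W => // i; have [Pi iu] := FW i; split=> //.
    by rewrite dotvZr iu -/h mulVf.
  (* Differences of facet points would be orthogonal to both [u] and [v], which are independent
     because [c] separates them; their rank would then be at most n - 2. *)
  exfalso; set D := (\matrix_(i < k) (p i - q i)) in rk.
  have Du : D *m u^T = 0.
    apply/colP => i; rewrite [RHS]mxE -dotv_row_mul rowK dotvDl dotvNl.
    by have [[_ ->] [_ ->]] := pqF i; rewrite subrr.
  have Dv : D *m v^T = 0.
    apply/colP => i; rewrite [RHS]mxE -dotv_row_mul rowK dotvDl dotvNl.
    by have [/Fv -> /Fv ->] := pqF i; rewrite subrr.
  have Fc : face P u c by split.
  have cu : dotv c u = h by [].
  have cv : dotv c v = 0 by exact: Fv.
  pose N := col_mx u v.
  have rN : row_free N.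
    apply: inj_row_free => w; rewrite -[w]hsubmxK mul_row_col.
    rewrite [lsubmx w]mx11_scalar [rsubmx w]mx11_scalar !mul_scalar_mx.
    set s := lsubmx w 0 0; set t := rsubmx w 0 0 => w0.
    have s0 : s = 0.
      move: (congr1 (dotv c) w0); rewrite dotv0r dotvDr !dotvZr cu cv mulr0 addr0.
      by move/eqP; rewrite mulf_eq0 (negbTE hn0) orbF => /eqP.
    move: w0; rewrite s0 scale0r add0r => /eqP; rewrite scaler_eq0 (negbTE v0) orbF.
    by move=> /eqP ->; rewrite raddf0 row_mx0.
  have DN : D *m N^T = 0 by rewrite tr_col_mx mul_mx_row Du Dv row_mx0.
  have := mulmx0_rank_max DN; rewrite mxrank_tr rk (eqP rN).
  by case: (n) n0 => // m _ /=; rewrite addn2 ltnn.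
have rowa i : dotv (row i W) a = 1 by case: (PW i).
have [i0 _] : exists i0 : 'I_n, true by exists (Ordinal n0).
have a0 : a != 0 by apply/eqP => a0; have := rowa i0; rewrite a0 dotv0r; lra.
pose r := Num.sqrt (dotv a a).
have r0 : 0 < r by rewrite sqrtr_gt0 lt_neqAle eq_sym dotv_eq0 a0 dotv_ge0.
have rr : r * r = dotv a a by rewrite -expr2 sqr_sqrtr // dotv_ge0.
pose u := r^-1 *: a.
have Pi i : P (row i W) by case: (PW i).
have rowu i : dotv (row i W) u = r^-1 by rewrite dotvZr rowa mulr1.
have hE : supp P u = r^-1.
  rewrite -(rowu i0); apply: supp_attained => // x Px.
  by rewrite rowu dotvZr ger_pMr ?invr_gt0 // Pa.
have u0 : u != 0 by rewrite scaler_eq0 invr_eq0 (gt_eqF r0).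
exists u; last by rewrite hE invrK scalerA divff ?scale1r // gt_eqF.
split; last first.
  by move=> [_]; rewrite dotv0l hE => /esym/eqP; rewrite invr_eq0 (gt_eqF r0).
split; first by rewrite dotvZl dotvZr -rr; field; rewrite gt_eqF.
exists n, (fun i => row i W), (fun=> row i0 W); split.
  by move=> i; split; split; rewrite ?hE.
set D := \matrix_i _.
have Du : D *m u^T = 0.
  apply/colP => i; rewrite [RHS]mxE -dotv_row_mul rowK dotvDl dotvNl !rowu.
  by rewrite subrr.
have := mulmx0_rank_max Du; rewrite mxrank_tr rank_rV u0 addn1 => le1.
(* The invertible [W] differs from [D] by a matrix of rank at most one, so [D] has rank at least n -
   1. *)
have WD : W = D + const_mx 1 *m row i0 W :> 'M[R]_n.
  apply/row_matrixP => i; rewrite linearD /= rowK row_mul.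
  rewrite (_ : row i (const_mx 1 : 'cV[R]_n) = 1%:M) ?mul1mx ?subrK //.
  by apply/matrixP => p q; rewrite !mxE !ord1.
have := mxrank_add D (const_mx 1 *m row i0 W); rewrite -WD mxrank_unit // => le2.
have le3 := leq_trans le2 (leq_add (leqnn _) (mulmx_max_rank (const_mx 1 : 'cV[R]_n) (row i0 W))).
apply/eqP; rewrite eqn_leq -ltnS prednK // le1 /=.
by rewrite -ltnS prednK // -addn1.
Qed.

End FacetDuals.

(** * Combinations of projection bodies are valuations *)

Section ProjectionBodies.
Context {R : realType} {n : nat}.
Variables c1 c2 : R.
Implicit Types (F P K : set 'rV[R]_n) (x y a : 'rV[R]_n).

(** Generators of the combined body when [F] is the set of facet duals; the origin is listed
    separately since [F] may be empty. *)
Definition spokes F : set 'rV[R]_n :=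
  [set x | x = 0 \/ exists2 a, F a & x = c1 *: a \/ x = - (c2 *: a)].

Lemma linf_sum_conv (S S' : set 'rV[R]_n) : linf_sum (conv S) (conv S') = conv (S `|` S').
Proof.
apply/seteqP; split; apply: conv_min; try exact: conv_convex.
  by move=> x [] /conv_sub; apply=> y Sy; [left|right].
by move=> x [] Sx; apply: sub_conv; [left|right]; exact: sub_conv.
Qed.

Lemma projection_body_spokes P : (0 < n)%N -> polytope_o P ->
  linf_sum (scale_set c1 (Pi_inf_plus P)) (scale_set c2 (Pi_inf_minus P)) =
  conv (spokes (facet_duals P)).
Proof.
move=> n0 pP; rewrite /Pi_inf_minus /Pi_inf_plus Pi_inf_plus_duals //.
set F := facet_duals P; set C := conv _.
have cC : convex_set C by exact: conv_convex.
have C0 : C 0 by apply: sub_conv; left.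
have CF a : F a -> C a by move=> Fa; apply: sub_conv; right.
apply/seteqP; split; apply: conv_min; try exact: conv_convex.
  have sub c : (forall a, F a -> spokes F (c *: a)) -> forall a, C a -> conv (spokes F) (c *: a).
    move=> Fc; apply: conv_min => [x y t /= xC yC t01|b [->|/Fc]]; last exact: sub_conv.
      rewrite scalerDr !scalerA !(mulrC c) -!scalerA; exact: conv_convex.
    by rewrite /= scaler0; apply: sub_conv; left.
  move=> _ [[a Ca <-]|[_ [a Ca <-] <-]].
    by apply: sub => // b Fb; right; exists b => //; left.
  rewrite scalerN -scaleNr; apply: sub => // b Fb; right; exists b => //; right.
  by rewrite scaleNr.
move=> x [->|[a Fa [->|->]]]; apply: sub_conv.
- by left; exists 0; rewrite ?scaler0.
- by left; exists a => //; exact: CF.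
- by right; exists (- a); rewrite ?scalerN //; exists a => //; exact: CF.
Qed.

Lemma spokesU F F' : spokes F `|` spokes F' = spokes (F `|` F').
Proof.
apply/seteqP; split=> x.
  by case=> [] [->|[a Fa h]]; [left|right; exists a => //; left|left|right; exists a => //; right].
case=> [->|[a [Fa|Fa] h]]; first by left; left.
  by left; right; exists a.
by right; right; exists a.
Qed.

(** Both sides are hulls of spokes, and spokes commute with unions, so the identity reduces to
    [facet_dualsU]. *)
Lemma projection_body_valuation : (0 < n)%N ->
  linf_valuation (fun P : set 'rV[R]_n =>
    linf_sum (scale_set c1 (Pi_inf_plus P)) (scale_set c2 (Pi_inf_minus P))).
Proof.
move=> n0 P Q pP pQ pU pI; rewrite !projection_body_spokes // !linf_sum_conv !spokesU.
by rewrite facet_dualsU //; exact: polytope_convex.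
Qed.

End ProjectionBodies.

(** * Contravariance of the projection bodies *)

Section Contravariance.
Context {R : realType} {n : nat}.
Implicit Types (P K : set 'rV[R]_n) (Z : set 'rV[R]_n -> set 'rV[R]_n).

Lemma lin_imgE (A : 'M[R]_n) K : lin_img A^T K = [set x *m A | x in K].
Proof. by rewrite /lin_img trmxK. Qed.

(* Contravariance without inverses: [M] acts on the right, i.e. [phi = M^T]. *)
Lemma SL_contravariantP Z : SL_contravariant Z <->
  (forall P (M : 'M[R]_n), polytope_o P -> \det M = 1 ->
     Z [set x *m M | x in P] = [set y | Z P (y *m M^T)]).
Proof.
have imgE (M : 'M[R]_n) K : M \in unitmx ->
    lin_img (invmx M^T)^T K = [set y | K (y *m M^T)].
  move=> uM; rewrite lin_imgE; apply/seteqP; split=> [_ [y Ky <-]|y Ky].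
    by rewrite /= -mulmxA mulVmx ?mulmx1 // unitmx_tr.
  by exists (y *m M^T); rewrite // -mulmxA mulmxV ?mulmx1 // unitmx_tr.
split=> h P M pP dM.
  have uM : M \in unitmx by rewrite unitmxE dM unitr1.
  by rewrite -lin_imgE h ?det_tr // imgE.
have uM : M^T \in unitmx by rewrite unitmx_tr unitmxE dM unitr1.
by rewrite /lin_img h ?det_tr // -imgE // trmxK.
Qed.

Lemma hull0_mul k m (V : 'M[R]_(k, m)) (A : 'M[R]_(m, n)) :
  [set x *m A | x in hull0 V] = hull0 (V *m A).
Proof.
apply/seteqP; split=> [_ [_ [w w01 ->] <-]|_ [w w01 ->]]; first by exists w; rewrite ?mulmxA.
by exists (w *m V); [exists w|rewrite mulmxA].
Qed.

Lemma polytope_mul P (A : 'M[R]_n) : polytope_o P -> polytope_o [set x *m A | x in P].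
Proof. by move=> /polytope_hull0[k [V ->]]; rewrite hull0_mul; exact: hull0_polytope. Qed.

Lemma projection_body_contravariant (c1 c2 : R) : (0 < n)%N ->
  SL_contravariant (fun P : set 'rV[R]_n =>
    linf_sum (scale_set c1 (Pi_inf_plus P)) (scale_set c2 (Pi_inf_minus P))).
Proof.
move=> n0; apply/SL_contravariantP => P M pP dM.
have uM : M \in unitmx by rewrite unitmxE dM unitr1.
have uMT : M^T \in unitmx by rewrite unitmx_tr.
rewrite !projection_body_spokes //; last exact: polytope_mul.
rewrite facet_duals_image //; apply/seteqP; split.
  apply: conv_min; first exact: convex_preimage (@conv_convex _ _ _).
  move=> x [->|[a Fa h]] /=; apply: sub_conv; first by left; rewrite mul0mx.
  right; exists (a *m M^T) => //; case: h => ->; [left|right].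
    by rewrite -scalemxAl.
  by rewrite mulNmx -scalemxAl.
move=> y /= Cy; rewrite -[y](mulmxK uMT); move: (y *m M^T) Cy => z.
apply: (@conv_min _ _ _ [set z | conv _ (z *m invmx M^T)]).
  exact: convex_preimage (@conv_convex _ _ _).
move=> x [->|[a Fa h]] /=; apply: sub_conv; first by left; rewrite mul0mx.
right; exists (a *m invmx M^T); first by rewrite /= mulmxKV.
by case: h => ->; [left|right]; rewrite ?mulNmx -scalemxAl.
Qed.

End Contravariance.

(** * Carathéodory's theorem and dissection into pieces of simplices *)

Section Dissection.
Context {R : realType} {n : nat}.
Implicit Types (x y z u v : 'rV[R]_n) (P Q : set 'rV[R]_n) (L : seq 'rV[R]_n).

(** A linear relation [d] among the rows is signed so that its coefficients have nonnegative sum.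
    Moving the weights along [- d] until one vanishes does not raise their total. The freed row
    depends on the others, so removing it preserves the rank. *)
Lemma caratheodory k (V : 'M[R]_(k, n)) (r : nat) x : \rank V = r -> hull0 V x ->
  exists f : {ffun 'I_r -> 'I_k}, row_free (rowsub f V) /\ hull0 (rowsub f V) x.
Proof.
elim: k V => [|k IH] V rV Vx.
  move: rV Vx; rewrite [V]flatmx0 mxrank0 => <- Vx.
  exists (finfun id); rewrite (_ : rowsub _ _ = 0); first by rewrite /row_free mxrank0.
  by apply/matrixP => -[].
have [rk|rk] := eqVneq r k.+1.
  rewrite rk in rV *; exists (finfun id).
  have -> : rowsub (finfun id) V = V by apply/matrixP => i j; rewrite mxE ffunE.
  by split=> //; rewrite /row_free rV.
have [d d0 [dV sd]] : exists2 d : 'rV[R]_k.+1, d != 0 & d *m V = 0 /\ 0 <= \sum_i d 0 i.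
  have [|u u0 Vu] := @exists_annihilator R _ _ V^T.
    by rewrite mxrank_tr rV ltn_neqAle rk -rV rank_leq_row.
  have uV : u *m V = 0 by apply: trmx_inj; rewrite trmx_mul Vu trmx0.
  have [su|su] := leP 0 (\sum_i u 0 i); first by exists u.
  exists (- u); first by rewrite oppr_eq0.
  split; first by rewrite mulNmx uV oppr0.
  by under eq_bigr do rewrite mxE; rewrite sumrN oppr_ge0 ltW.
have [i0 di0] : exists i, 0 < d 0 i.
  apply: contrapT => /forallNP dn; move: d0; apply/negP; rewrite negbK; apply/eqP.
  have dle i : d 0 i <= 0 by rewrite leNgt; exact/negP.
  have : \sum_i - d 0 i == 0.
    by rewrite eq_le sumr_ge0 ?sumrN ?oppr_le0 ?sd // => i _; rewrite oppr_ge0.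
  rewrite psumr_eq0 => [/allP h|i _]; last by rewrite oppr_ge0.
  by apply/rowP => i; rewrite mxE; apply/eqP; rewrite -oppr_eq0; exact: h (mem_index_enum _).
case: Vx => w [w0 w1] xw.
have [i di imin] : exists2 i, 0 < d 0 i & forall j, 0 < d 0 j -> w 0 i / d 0 i <= w 0 j / d 0 j.
  by case: (@arg_minP _ _ _ i0 (fun i => 0 < d 0 i) (fun i => w 0 i / d 0 i) di0) => i; exists i.
pose t := w 0 i / d 0 i; pose w' := w - t *: d.
have t0 : 0 <= t by rewrite divr_ge0 // ltW.
have w'0 j : 0 <= w' 0 j.
  rewrite !mxE subr_ge0; have [dj|dj] := ltP 0 (d 0 j).
    by rewrite -ler_pdivlMr //; exact: imin.
  by apply: le_trans (w0 j); rewrite mulr_ge0_le0.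
have w'i : w' 0 i = 0 by rewrite !mxE divfK ?subrr // gt_eqF.
have xw' : x = w' *m V by rewrite mulmxBl -scalemxAl dV scaler0 subr0.
have rowE j : row (lift i j) V = row j (row' i V) by apply/rowP => l; rewrite !mxE.
have [] := IH (row' i V).
- rewrite -rV; apply/eqP; rewrite eqn_leq; apply/andP; split; apply: mxrankS.
    by apply/row_subP => j; rewrite -rowE row_sub.
  have sub j : (row (lift i j) V <= row' i V)%MS by rewrite rowE row_sub.
  apply/row_subP => j; case: (unliftP i j) => [j' ->|->] //.
  move: dV; rewrite lincomb_row (bigD1_ord i) //= => /eqP; rewrite addr_eq0 => /eqP h.
  rewrite -(eqmx_scale (row i V) (a := d 0 i)) ?gt_eqF // h eqmx_opp.
  by apply: summx_sub => j' _; apply: scalemx_sub.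
- exists (col' i w').
    split=> [j|]; first by rewrite mxE.
    have : \sum_j w' 0 j <= 1.
      under eq_bigr do rewrite !mxE.
      by rewrite sumrB -mulr_sumr; have := mulr_ge0 t0 sd; lra.
    rewrite (bigD1_ord i) //= w'i add0r.
    by under [in X in _ -> X]eq_bigr do rewrite mxE.
  rewrite xw' !lincomb_row (bigD1_ord i) //= w'i scale0r add0r.
  by apply: eq_bigr => j _; rewrite -rowE [col' i w' 0 j]mxE.
move=> f [ff fx]; exists [ffun j => lift i (f j)].
have -> // : rowsub [ffun j => lift i (f j)] V = rowsub f (row' i V).
by apply/matrixP => j l; rewrite !mxE ffunE.
Qed.

Definition dual_cone L : set 'rV[R]_n := [set x | forall u, u \in L -> 0 <= dotv x u].

Lemma dual_cone_convex L : convex_set (dual_cone L).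
Proof.
move=> x y t Lx Ly /andP[t0 t1] u uL; rewrite dotvDl !dotvZl.
by rewrite addr_ge0 // mulr_ge0 ?subr_ge0 //; [exact: Lx|exact: Ly].
Qed.

Lemma segment_keeps_signs L x y : exists2 e : R, 0 < e < 1 &
  forall u, u \in L -> (0 < dotv x u -> 0 < dotv ((1 - e) *: x + e *: y) u) /\
    (dotv x u < 0 -> dotv ((1 - e) *: x + e *: y) u < 0).
Proof.
(* All smaller steps are included so that the induction over [L] can take minima. *)
suff [e0 /andP[e00 e01] h] : exists2 e0 : R, 0 < e0 < 1 & forall e, 0 < e -> e <= e0 ->
  forall u, u \in L -> (0 < dotv x u -> 0 < dotv ((1 - e) *: x + e *: y) u) /\
    (dotv x u < 0 -> dotv ((1 - e) *: x + e *: y) u < 0).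
  by exists e0; rewrite ?e00 //; apply: h.
elim: L => [|u L [e0 /andP[e00 e01] IH]]; first by exists 2^-1 => //; apply/andP; split; lra.
set A := dotv x u; set B := dotv y u.
have [A0|A0] := eqVneq A 0.
  exists e0; rewrite ?e00 // => e ep ee v; rewrite inE => /orP[/eqP->|vL]; last exact: IH.
  by rewrite -/A A0 ltxx.
have s0 : 0 < `|A| + `|B| + 1 by rewrite ltr_wpDl // addr_ge0.
have Apos : 0 < `|A| by rewrite normr_gt0.
exists (Num.min e0 (`|A| / (`|A| + `|B| + 1))).
  rewrite lt_min e00 divr_gt0 //=; apply: le_lt_trans e01; by rewrite ge_min lexx.
move=> e ep; rewrite le_min => /andP[ee eA] v; rewrite inE => /orP[/eqP->|vL]; last exact: IH.
rewrite ler_pdivlMr // in eA.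
have eA' : e * `|A| + e * `|B| < `|A| by rewrite mulrDr mulr1 mulrDr in eA; lra.
rewrite dotvDl !dotvZl -/A -/B.
have := ler_norm (e * B); have := ler_norm (- (e * B)); rewrite normrN normrM (gtr0_norm ep) => h1 h2.
by split=> As; [rewrite (gtr0_norm As) in eA'|rewrite (ltr0_norm As) in eA']; lra.
Qed.

(* The hyperplanes through the facets of the simplices conv(0, V_f) and those where two of
   these simplices have facets over the same ray cut conv(0, V) into pieces of single simplices. *)
Lemma simplicial_refinement k (V : 'M[R]_(k, n)) (r : nat) : \rank V = r -> (0 < r)%N ->
  exists L, forall L', (forall u, u \in L -> u \in L' \/ - u \in L') ->
    (exists2 l, (exists2 x, hull0 V x & dotv x l != 0) &
       forall x, hull0 V x -> dual_cone L' x -> dotv x l = 0) \/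
    (exists2 f : {ffun 'I_r -> 'I_k}, row_free (rowsub f V) &
       (exists2 s, (forall j, dotv (row (f j) V) s = 1) &
                   forall x, hull0 V x -> dotv x s <= 1) /\
       hull0 V `&` dual_cone L' = hull0 (rowsub f V) `&` dual_cone L').
Proof.
(* When the selected rows are independent, [C f] reads off coordinates with respect to them, [c f j]
   is a single coordinate functional, and [s f], their sum, equals 1 at each of these rows. *)
move=> rV r0; pose C (f : {ffun 'I_r -> 'I_k}) := pinvmx (rowsub f V).
pose c f j : 'rV[R]_n := row j (C f)^T.
pose s f : 'rV[R]_n := \sum_j c f j.
have cE f j x : dotv x (c f j) = (x *m C f) 0 j.
  by rewrite dotvC dotv_row_mul -trmx_mul mxE.
have sE f x : dotv x (s f) = \sum_j (x *m C f) 0 j.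
  by rewrite dotvC dotv_suml; apply: eq_bigr => j _; rewrite dotvC cE.
have VC (f : {ffun 'I_r -> 'I_k}) : row_free (rowsub f V) -> rowsub f V *m C f = 1%:M by exact: mulmxVp.
have hullC (f : {ffun 'I_r -> 'I_k}) x w : row_free (rowsub f V) -> x = w *m rowsub f V -> x *m C f = w.
  by move=> ff ->; rewrite -mulmxA VC // mulmx1.
have CV (f : {ffun 'I_r -> 'I_k}) x : row_free (rowsub f V) -> hull0 V x -> x *m C f *m rowsub f V = x.
  move=> ff [w _ ->]; apply: mulmxKpV; apply: submx_trans (submxMl _ _) _.
  have fV : (rowsub f V <= V)%MS by apply/row_subP => j; rewrite row_rowsub row_sub.
  by rewrite -(mxrank_leqif_sup fV) rV.
have hullV (f : {ffun 'I_r -> 'I_k}) : hull0 (rowsub f V) `<=` hull0 V.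
  by apply: hull0_sub => j; rewrite row_rowsub; exact: hull0_row.
pose L := [seq c f j | f <- enum {ffun 'I_r -> 'I_k}, j <- enum 'I_r] ++
  [seq s f - s g | f <- enum {ffun 'I_r -> 'I_k}, g <- enum {ffun 'I_r -> 'I_k}].
have cL f j : c f j \in L.
  by rewrite mem_cat; apply/orP; left; apply/allpairsP; exists (f, j); rewrite !mem_enum.
have sL f g : s f - s g \in L.
  by rewrite mem_cat; apply/orP; right; apply/allpairsP; exists (f, g); rewrite !mem_enum.
exists L => L' LL'; pose Q := hull0 V `&` dual_cone L'.
have [|ndeg] := pselect (exists2 l, (exists2 x, hull0 V x & dotv x l != 0) &
    forall x, hull0 V x -> dual_cone L' x -> dotv x l = 0); [by left|right].
pose nv l := exists2 x, hull0 V x & dotv x l != 0.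
have Qnv l : nv l -> exists2 x, Q x & dotv x l != 0.
  move=> nvl; apply: contrapT => h; apply: ndeg; exists l => // x Vx Lx.
  by apply/eqP/negPn/negP => xl; apply: h; exists x.
have const_sign u : u \in L -> (forall x, Q x -> 0 <= dotv x u) \/ (forall x, Q x -> dotv x u <= 0).
  move=> /LL' [] uL'; [left|right] => x [_ Lx]; first exact: Lx.
  by have := Lx _ uL'; rewrite dotvNr oppr_ge0.
have cQ : convex_set Q by apply: convex_setI; [exact: hull0_convex|exact: dual_cone_convex].
(* A generic point of the piece: averaging preserves nonvanishing because each member of [L] has
   constant sign on [Q]. *)
have [q Qq qnv] : exists2 q, Q q & forall u, u \in L -> nv u -> dotv q u != 0.
  have : {subset L <= L} by [].
  elim: {1 3}L => [|u L0 IH] sub.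
    exists 0 => //; split; first exact: hull0_0.
    by move=> u _; rewrite dotv0l.
  have [|q Qq qnv] := IH; first by move=> v vL; apply: sub; rewrite inE vL orbT.
  have [nvu|nvu] := pselect (nv u); last first.
    by exists q => // v; rewrite inE => /orP[/eqP->|/qnv].
  have [q' Qq' q'u] := Qnv u nvu.
  exists ((1 - 2^-1) *: q + 2^-1 *: q'); first by apply: cQ => //; apply/andP; split; lra.
  move=> v vL nvv; rewrite dotvDl !dotvZl.
  have v0 : dotv q v != 0 \/ dotv q' v != 0.
    by move: vL; rewrite inE => /orP[/eqP->|vL]; [right|left; exact: qnv].
  apply/eqP => h; have [qv q'v] : dotv q v = 0 /\ dotv q' v = 0.
    by case: (const_sign v (sub _ vL)) => sg; have := sg _ Qq; have := sg _ Qq'; split; lra.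
  by case: v0; rewrite ?qv ?q'v eqxx.
have nvc (f : {ffun 'I_r -> 'I_k}) j : row_free (rowsub f V) -> nv (c f j).
  move=> ff; exists (row (f j) V); first exact: hull0_row.
  by rewrite cE -row_rowsub -row_mul VC // !mxE eqxx oner_eq0.
pose B (f : {ffun 'I_r -> 'I_k}) := row_free (rowsub f V) && [forall j, 0 < (q *m C f) 0 j].
have Vq : hull0 V q by case: Qq.
have [f0 Bf0] : exists f0, B f0.
  have [f [ff fq]] := caratheodory rV Vq; exists f; rewrite /B ff; apply/forallP => j.
  rewrite lt_neqAle eq_sym -cE qnv //=; last exact: nvc.
  by case: fq => w [w0 _] qw; rewrite cE (hullC _ _ _ ff qw).
(* Among the simplices with [q] in the interior of their cone, the chosen one has the facet that the
   ray through [q] meets last. *)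
have [f Bf fmin] : exists2 f, B f & forall g, B g -> dotv q (s f) <= dotv q (s g).
  by case: (@arg_minP _ _ _ f0 B (fun f => dotv q (s f)) Bf0) => f; exists f.
have /andP[ff /forallP qf] := Bf.
have sq : 0 < dotv q (s f).
  rewrite sE (bigD1 (Ordinal r0)) //= ltr_pwDl //.
  by apply: sumr_ge0 => j _; exact: ltW.
exists f => //; have sfV j : dotv (row (f j) V) (s f) = 1.
  rewrite sE -row_rowsub -row_mul VC // (bigD1 j) //= big1 ?mxE ?eqxx ?addr0 // => l lj.
  by rewrite !mxE eq_sym (negbTE lj).
(* Otherwise a small step from the exit point [q1] towards [x] reaches a point [qe] beyond the facet
   of [f]. A simplex [g] containing [qe] still has [q] in its cone, and minimality of [f], carried
   from [q] to [qe], gives [s f <= s g <= 1] at [qe]. *)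
have sfP x : hull0 V x -> dotv x (s f) <= 1.
  move=> Vx; rewrite leNgt; apply/negP => sx.
  pose q1 := (dotv q (s f))^-1 *: q.
  have Vq1 : hull0 V q1.
    apply: (hullV f); exists ((dotv q (s f))^-1 *: (q *m C f)).
      split=> [j|]; first by rewrite mxE mulr_ge0 ?invr_ge0 // ltW.
      by under eq_bigr do rewrite mxE; rewrite -mulr_sumr -sE mulVf // gt_eqF.
    by rewrite -scalemxAl CV.
  have [e /andP[e0 e1] signs] := segment_keeps_signs L q1 x.
  set qe := _ + _ in signs.
  have Vqe : hull0 V qe by apply: hull0_convex; rewrite ?ltW.
  have [g [fg [w [w0 w1] qew]]] := caratheodory rV Vqe.
  have qew' := hullC _ _ _ fg qew.
  have Bg : B g.
    rewrite /B fg; apply/forallP => j; rewrite -cE.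
    have := qnv _ (cL g j) (nvc g j fg); case: (ltgtP (dotv q (c g j)) 0) => // neg _.
    have [_] := signs _ (cL g j); rewrite {1}/q1 dotvZl pmulr_rlt0 ?invr_gt0 // => /(_ neg).
    by rewrite cE qew' ltNge w0.
  have sge : dotv qe (s g) <= 1 by rewrite sE qew'.
  have : dotv qe (s f) <= 1.
    apply: le_trans sge; rewrite -subr_le0 -dotvNr -dotvDr.
    have [nvu|nvu] := pselect (nv (s f - s g)); last first.
      by apply: contrapT => h; apply: nvu; exists qe => //; apply/eqP => h0; apply: h; rewrite h0.
    have [_ h] := signs _ (sL f g); apply: ltW; apply: h.
    rewrite /q1 dotvZl pmulr_rlt0 ?invr_gt0 // lt_neqAle qnv //=.
    by rewrite dotvDr dotvNr subr_le0 fmin.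
  rewrite /qe dotvDl !dotvZl mulVf ?gt_eqF // leNgt => /negP; apply.
  have : 0 < e * (dotv x (s f) - 1) by rewrite mulr_gt0 // subr_gt0.
  lra.
split; first by exists (s f).
apply/seteqP; split=> x [Vx Lx]; split=> //; last exact: hullV Vx.
exists (x *m C f); last by rewrite CV.
split; last by rewrite -sE sfP.
move=> j; rewrite -cE; case: (const_sign _ (cL f j)) => [|neg]; first by apply.
by have := neg _ Qq; rewrite cE leNgt qf.
Qed.

End Dissection.

(** A bordered matrix is factored into block triangular matrices in two ways, and the determinants
    are compared. *)
Lemma det_add_rank1 (R : comNzRingType) m (u v : 'rV[R]_m) :
  \det (1%:M + u^T *m v) = 1 + (v *m u^T) 0 0.
Proof.
pose A : 'M[R]_(1 + m) := block_mx 1%:M (- v) u^T 1%:M.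
have A1 : A = block_mx 1%:M 0 u^T 1%:M *m block_mx 1%:M (- v) 0 (1%:M + u^T *m v).
  rewrite mulmx_block !mul1mx !mulmx1 !mul0mx !addr0 mulmxN.
  by rewrite addrCA addNr addr0.
have A2 : A = block_mx (1%:M + v *m u^T) (- v) 0 1%:M *m block_mx 1%:M 0 u^T 1%:M.
  rewrite mulmx_block ?mulmx1 ?mul0mx ?mulmx0 ?add0r ?addr0 ?mul1mx mulNmx.
  by rewrite -addrA subrr addr0.
have : \det A = \det (1%:M + u^T *m v) by rewrite A1 det_mulmx det_lblock det_ublock !det1 !mul1r.
move=> <-; rewrite A2 det_mulmx det_lblock det_ublock !det1 !mulr1 det_mx11.
by rewrite !mxE eqxx.
Qed.

(** * Doubling arguments and real roots *)

Section Archimedes.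
Context {R : realType}.

Lemma exists_exp2_gt (b : R) : exists k : nat, b < 2 ^+ k.
Proof.
by exists (Num.bound b); apply: upper_nthrootP. Qed.

(** The form in which boundedness of a value is exploited: what can be doubled indefinitely is
    zero. *)
Lemma exp2_bounded_eq0 (a b : R) : (forall k : nat, 2 ^+ k * `|a| <= b) -> a = 0.
Proof.
move=> h; apply/eqP; rewrite -normr_le0 leNgt; apply/negP => a0.
have [k hk] := exists_exp2_gt (b / `|a|).
by have := h k; rewrite leNgt -ltr_pdivrMr // hk.
Qed.

Lemma affine_bounded_slope0 (a c b : R) : (forall s, `|a + s * c| <= b) -> c = 0.
Proof.
move=> h; apply: (@exp2_bounded_eq0 _ (b + `|a|)) => k.
have := h (2 ^+ k); have := ler_normB (a + 2 ^+ k * c) a.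
rewrite addrAC subrr add0r normrM ger0_norm ?exprn_ge0 // => h1 h2.
by apply: le_trans h1 _; rewrite lerD2r.
Qed.

Lemma exists_root (m : nat) (t : R) : (0 < m)%N -> 0 < t -> exists2 r : R, 0 < r & r ^+ m = t.
Proof.
move=> m0 t0; exists (expR (ln t / m%:R)); first exact: expR_gt0.
by rewrite -expRM_natl mulrC divfK ?lnK // pnatr_eq0 -lt0n.
Qed.

End Archimedes.

(** * Shears that cut a simplex across an edge *)

Section Shears.
Context {R : realType} {n : nat}.
Implicit Types (i j : 'I_n) (t : R) (x y : 'rV[R]_n).

(* Row [j] is [(1 - t) e_i + t e_j], the other rows are those of the identity. *)
Definition shear i j t : 'M[R]_n :=
  1%:M + (delta_mx 0 j : 'rV_n)^T *m ((1 - t) *: (delta_mx 0 i - delta_mx 0 j)).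

Lemma det_shear i j t : i != j -> \det (shear i j t) = t.
Proof.
move=> ij; rewrite det_add_rank1 -[(_ *m _) 0 0]/(dotv _ _) dotv_delta !mxE !eqxx /=.
by rewrite eq_sym (negbTE ij) mulr0n; ring.
Qed.

Lemma mul_shear i j t x : x *m shear i j t = x + (x 0 j * (1 - t)) *: (delta_mx 0 i - delta_mx 0 j).
Proof.
rewrite mulmxDr mulmx1 mulmxA; congr (_ + _).
rewrite [x *m _]mx11_scalar -[(_ *m _) 0 0]/(dotv x (delta_mx 0 j)) dotv_delta.
by rewrite mul_scalar_mx scalerA.
Qed.

Lemma mul_shear_tr i j t y :
  y *m (shear i j t)^T = y + ((1 - t) * (y 0 i - y 0 j)) *: delta_mx 0 j.
Proof.
rewrite linearD /= trmx1 trmx_mul trmxK mulmxDr mulmx1 mulmxA; congr (_ + _).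
rewrite [y *m _]mx11_scalar mul_scalar_mx; congr (_ *: _).
by rewrite -[LHS]/(dotv y _) dotvZr dotvDr dotvNr !dotv_delta.
Qed.

End Shears.

(** The hyperplane of [u] contains the other rows and meets the edge at [(1 - t) V_i + t V_j], which
    replaces [V_j]. Values of [u] are computed from weights, so dependent or zero rows are
    allowed. *)
Lemma hull0_shear {R : realType} k n (V : 'M[R]_(k, n)) (i j : 'I_k) (t : R) (u : 'rV[R]_n) :
  i != j -> 0 < t < 1 ->
  (forall l, dotv (row l V) u = t * (l == i)%:R - (1 - t) * (l == j)%:R) ->
  hull0 V `&` [set x | 0 <= dotv x u] = hull0 (shear i j t *m V).
Proof.
move=> ij /andP[t0 t1] Vu.
have uE (w : 'rV[R]_k) : dotv (w *m V) u = t * w 0 i - (1 - t) * w 0 j.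
  rewrite lincomb_row dotv_suml; under eq_bigr do rewrite dotvZl Vu mulrBr.
  rewrite big_split /= (bigD1 i) //= [X in _ + X + _]big1 ?addr0; last first.
    by move=> l /negbTE ->; rewrite !mulr0.
  rewrite (bigD1 j) //= [X in _ + (_ + X)]big1 ?addr0; last first.
    by move=> l /negbTE ->; rewrite !mulr0 oppr0.
  by rewrite !eqxx !mulr1n; ring.
have sumE (w : 'rV[R]_k) c :
    \sum_l (w + c *: (delta_mx 0 i - delta_mx 0 j)) 0 l = \sum_l w 0 l.
  have sum_delta i0 : \sum_(l < k) (l == i0)%:R = 1 :> R.
    by rewrite (bigD1 i0) //= eqxx big1 ?addr0 // => l /negbTE ->.
  under eq_bigr do rewrite !mxE eqxx /=.
  by rewrite big_split /= -mulr_sumr sumrB !sum_delta subrr mulr0 addr0.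
have ji : (j == i) = false by rewrite eq_sym (negbTE ij).
apply/seteqP; split=> [x [[w [w0 w1] ->]]|x [w [w0 w1] ->]].
  rewrite /= uE => wij.
  (* The preimage of [w] under the shear; its [i]-th weight is nonnegative exactly by [wij]. *)
  pose w' : 'rV[R]_k := w + (- ((1 - t) / t * w 0 j)) *: (delta_mx 0 i - delta_mx 0 j).
  have w'j : w' 0 j = w 0 j / t.
    by rewrite !mxE !eqxx ji mulr0n mulr1n; field; rewrite gt_eqF.
  suff h : (forall l, 0 <= w' 0 l) /\ \sum_l w' 0 l <= 1.
    exists w' => //.
    rewrite mulmxA mul_shear w'j /w' -addrA -scalerDl.
    have -> : - ((1 - t) / t * w 0 j) + w 0 j / t * (1 - t) = 0 by field; rewrite gt_eqF.
    by rewrite scale0r addr0.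
  split; last by rewrite sumE.
  move=> l; have [->|lj] := eqVneq l j; first by rewrite w'j divr_ge0 // ltW.
  rewrite !mxE eqxx (negbTE lj) subr0; have [->|li] := eqVneq l i; last by rewrite mulr0 addr0.
  rewrite mulr1 subr_ge0 -(ler_pM2l t0).
  have -> : t * ((1 - t) / t * w 0 j) = (1 - t) * w 0 j by field; rewrite gt_eqF.
  lra.
have xE : w *m shear i j t = w + (w 0 j * (1 - t)) *: (delta_mx 0 i - delta_mx 0 j).
  exact: mul_shear.
have wj0 : 0 <= w 0 j * (1 - t) by rewrite mulr_ge0 // subr_ge0 ltW.
rewrite mulmxA; split.
  exists (w *m shear i j t) => //; split; last by rewrite xE sumE.
  move=> l; rewrite xE !mxE eqxx /=; have [->|lj] := eqVneq l j.
    by rewrite ji sub0r mulrN1; have := w0 j; have := mulr_ge0 (w0 j) (ltW t0); lra.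
  by rewrite subr0 addr_ge0 // mulr_ge0 // ler0n.
rewrite /= uE xE !mxE !eqxx ji (negbTE ij) !mulr0n !mulr1n.
have -> : t * (w 0 i + w 0 j * (1 - t) * (1 - 0)) - (1 - t) * (w 0 j + w 0 j * (1 - t) * (0 - 1))
  = t * w 0 i by ring.
by rewrite mulr_ge0 // ltW.
Qed.

(** * Values of a contravariant valuation under cuts through the origin *)

Section Valuation.
Context {R : realType} {m : nat}.
Local Notation n := m.+3.
Context (Z : set 'rV[R]_n -> set 'rV[R]_n).
Context (Zbody : forall P, polytope_o P -> body_o (Z P)).
Context (Zval : linf_valuation Z).
Context (Zcontra : forall P (M : 'M[R]_n), polytope_o P -> \det M = 1 ->
  Z [set x *m M | x in P] = [set y | Z P (y *m M^T)]).
Implicit Types (P K : set 'rV[R]_n) (x y u v a : 'rV[R]_n) (L : seq 'rV[R]_n).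

Definition half u : set 'rV[R]_n := [set x | 0 <= dotv x u].
Definition hyperplane u : set 'rV[R]_n := [set x | dotv x u = 0].

Lemma value_convex P : polytope_o P -> convex_set (Z P).
Proof. by move=> /Zbody[_ []]. Qed.

Lemma value0 P : polytope_o P -> Z P 0.
Proof. by move=> /Zbody[_ []]. Qed.

Lemma value_bounded P u : polytope_o P -> exists b : R, forall y, Z P y -> `|dotv y u| <= b.
Proof. by move=> /Zbody[cZ _]; exact: compact_dotv_bounded. Qed.

Lemma value_conv P : polytope_o P -> conv (Z P) = Z P.
Proof. by move=> /value_convex; exact: conv_id. Qed.

Lemma polytope_hyperplane P u : polytope_o P -> polytope_o (P `&` hyperplane u).
Proof.
move=> pP; have := polytope_halfspace (- u) (polytope_halfspace u pP).
congr polytope_o; apply/seteqP; split=> x /=; rewrite dotvNr oppr_ge0.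
  by move=> [[Px x0] x1]; split=> //; apply/eqP; rewrite eq_le x0 x1.
by rewrite /hyperplane /= => -[Px ->].
Qed.

(* Transvections along [u^perp] fix [P], and they translate the points of [Z P] along [u]. *)
Lemma value_in_hyperplane P u : polytope_o P -> u != 0 -> P `<=` hyperplane u ->
  forall y, Z P y -> exists c : R, y = c *: u.
Proof.
move=> pP u0 Pu y Zy; have uu : dotv u u != 0 by rewrite dotv_eq0.
have orth v : dotv v u = 0 -> dotv y v = 0.
  move=> vu; have [b Zb] := value_bounded u pP.
  suff : dotv y v * dotv u u = 0 by move/eqP; rewrite mulf_eq0 (negbTE uu) orbF => /eqP.
  apply: (@affine_bounded_slope0 _ (dotv y u) _ b) => s.
  pose M : 'M[R]_n := 1%:M + u^T *m (s *: v).
  have dM : \det M = 1.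
    by rewrite det_add_rank1 -[(_ *m _) 0 0]/(dotv _ _) dotvZl vu mulr0 addr0.
  have PM : [set x *m M | x in P] = P.
    have xM x : P x -> x *m M = x.
      move=> /Pu xu; rewrite mulmxDr mulmx1 mulmxA [x *m _]mx11_scalar.
      by rewrite -[(_ *m _) 0 0]/(dotv x u) xu mul_scalar_mx scale0r addr0.
    by apply/seteqP; split=> [_ [x Px <-]|x Px]; [rewrite xM|exists x; rewrite ?xM].
  have := Zcontra pP dM; rewrite PM => ZM; move: Zy; rewrite {1}ZM /= => Zy'.
  have yM : y *m M^T = y + (s * dotv y v) *: u.
    rewrite linearD /= trmx1 trmx_mul trmxK mulmxDr mulmx1 mulmxA; congr (_ + _).
    by rewrite [y *m _]mx11_scalar mul_scalar_mx -[(_ *m _) 0 0]/(dotv _ _) dotvZr.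
  by have := Zb _ Zy'; rewrite yM dotvDl dotvZl -mulrA.
exists (dotv y u / dotv u u); apply/eqP; rewrite -subr_eq0 -dotv_eq0.
set c := _ / _; set v := y - _.
have vu : dotv v u = 0 by rewrite /v dotvDl dotvNl dotvZl divfK // subrr.
by rewrite {1}/v dotvDl dotvNl dotvZl orth // dotvC vu mulr0 subrr.
Qed.

(** The value lies on two distinct normal lines, which meet only in the origin. *)
Lemma value_codim2 P u v : polytope_o P -> u != 0 -> (forall c : R, v != c *: u) ->
  P `<=` hyperplane u -> P `<=` hyperplane v -> Z P `<=` [set 0].
Proof.
move=> pP u0 vu Pu Pv y Zy.
have v0 : v != 0 by have := vu 0; rewrite scale0r.
have [c yc] := value_in_hyperplane pP u0 Pu Zy.
have [d yd] := value_in_hyperplane pP v0 Pv Zy.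
have [d0|d0] := eqVneq d 0; first by rewrite /= yd d0 scale0r.
by have := vu (d^-1 * c); rewrite -scalerA -yc yd scalerA mulVf // scale1r eqxx.
Qed.

Lemma value_cut P u : polytope_o P ->
  linf_sum (Z P) (Z (P `&` hyperplane u)) =
  linf_sum (Z (P `&` half u)) (Z (P `&` half (- u))).
Proof.
move=> pP.
have hU : (P `&` half u) `|` (P `&` half (- u)) = P.
  rewrite -setIUr; apply/setIidPl => x _ /=; rewrite /half /= dotvNr oppr_ge0.
  by case: (leP 0 (dotv x u)) => [|/ltW]; [left|right].
have hI : (P `&` half u) `&` (P `&` half (- u)) = P `&` hyperplane u.
  rewrite -setIIr; congr (_ `&` _); apply/seteqP; split=> x; rewrite /half /= dotvNr oppr_ge0.
    by move=> [x0 x1]; apply/eqP; rewrite eq_le x0 x1.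
  by rewrite /hyperplane /= => ->.
rewrite -{1}hU -hI; apply: Zval; rewrite ?hU ?hI //; try exact: polytope_halfspace.
exact: polytope_hyperplane.
Qed.

Lemma value_cut_le P u M : polytope_o P -> convex_set M ->
  Z (P `&` half u) `<=` M -> Z (P `&` half (- u)) `<=` M -> Z P `<=` M.
Proof.
move=> pP cM ZM ZM' y Zy.
have : linf_sum (Z P) (Z (P `&` hyperplane u)) y by apply: sub_conv; left.
by rewrite value_cut //; apply: conv_min => // z [/ZM|/ZM'].
Qed.

(** Once the value at the section is absorbed, the hull of the values at the two halves is [Z P]
    itself. *)
Lemma value_cut_ge P u : polytope_o P -> Z (P `&` hyperplane u) `<=` Z P ->
  Z (P `&` half u) `<=` Z P.
Proof.
move=> pP ZP y Zy.
have : linf_sum (Z (P `&` half u)) (Z (P `&` half (- u))) y by apply: sub_conv; left.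
by rewrite -value_cut // /linf_sum setUC (setUidr ZP) value_conv.
Qed.

Lemma dual_cone_cons P u L : P `&` dual_cone (u :: L) = (P `&` half u) `&` dual_cone L.
Proof.
rewrite -setIA; congr (_ `&` _); apply/seteqP; split=> x.
  move=> h; split; first by apply: h; rewrite mem_head.
  by move=> v vL; apply: h; rewrite inE vL orbT.
by move=> [xu h] v; rewrite inE => /orP[/eqP->|/h].
Qed.

Lemma dual_cone_nil P : P `&` dual_cone [::] = P.
Proof. by apply/setIidPl => x _ u. Qed.

(** The members of [L] cut one after the other by [value_cut_le]; [L'] records the sides chosen. *)
Lemma value_pieces_le L M P : convex_set M -> polytope_o P ->
  (forall L', (forall u, u \in L -> u \in L' \/ - u \in L') -> Z (P `&` dual_cone L') `<=` M) ->
  Z P `<=` M.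
Proof.
move=> cM; elim: L P => [|u L IH] P pP h.
  by rewrite -(dual_cone_nil P); apply: h.
have pieces v : v = u \/ v = - u -> Z (P `&` half v) `<=` M.
  move=> vu; apply: IH => [|L' LL']; first exact: polytope_halfspace.
  rewrite -dual_cone_cons; apply: h => w; rewrite inE => /orP[/eqP->|/LL'].
    case: vu => ->; [left|right]; exact: mem_head.
  by rewrite !inE => -[] ->; [left|right]; rewrite orbT.
by apply: (@value_cut_le P u); [|  |apply: pieces; left|apply: pieces; right].
Qed.

Lemma polytope_dual_cone L P : polytope_o P -> polytope_o (P `&` dual_cone L).
Proof.
elim: L P => [|u L IH] P pP; first by rewrite dual_cone_nil.
by rewrite dual_cone_cons; apply: IH; exact: polytope_halfspace.
Qed.

(** [D] is a family stable under cuts. It is used first for polytopes in a fixed hyperplane, where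
    sections have codimension two, and then for all polytopes. *)
Lemma value_piece_ge (D : set 'rV[R]_n -> Prop) :
  (forall P u, polytope_o P -> D P -> D (P `&` half u)) ->
  (forall P u, polytope_o P -> D P -> P `<=` hyperplane u \/ Z (P `&` hyperplane u) `<=` [set 0]) ->
  forall L P, polytope_o P -> D P -> Z (P `&` dual_cone L) `<=` Z P.
Proof.
move=> Dhalf Dcut; elim=> [|u L IH] P pP DP; first by rewrite dual_cone_nil.
rewrite dual_cone_cons; apply: subset_trans (IH _ _ _) _.
- exact: polytope_halfspace.
- exact: Dhalf.
case: (Dcut P u pP DP) => h; last first.
  by apply: value_cut_ge => // y /h ->; exact: value0.
by rewrite (_ : P `&` half u = P) //; apply/setIidPl => x /h; rewrite /half /= => ->.
Qed.


(** * Values at polytopes contained in a hyperplane *)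

Section StandardFacet.
Variables (i0 i1 i2 : 'I_n).
Hypotheses (i01 : i0 != i1) (i02 : i0 != i2) (i12 : i1 != i2).
Let e0 : 'rV[R]_n := delta_mx 0 i0.
(** Row [i0] is zero and the others are unit vectors, so [hull0 E] is an (n-1)-simplex written with
    a square matrix, to which n by n maps apply. *)
Let E : 'M[R]_n := 1%:M - e0^T *m e0.

Lemma row_E l : row l E = (l != i0)%:R *: delta_mx 0 l.
Proof.
rewrite linearB /= row1 row_mul.
have -> : row l e0^T = (l == i0)%:R%:M.
  by apply/rowP => q; rewrite !mxE ord1 !eqxx.
rewrite mul_scalar_mx; have [->|_] := eqVneq l i0; first by rewrite !scale1r subrr scale0r.
by rewrite scale0r subr0 scale1r.
Qed.

Lemma dotv_e0 : dotv e0 e0 = 1 :> R.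
Proof. by rewrite dotv_delta mxE !eqxx. Qed.

(* Halving the simplex [hull0 E] and stretching along [e0] is volume preserving. *)
Lemma value_standard_half (i j : 'I_n) y : i0 != i -> i0 != j -> i != j ->
  Z (hull0 (shear i j (2^-1 : R) *m E)) y -> Z (hull0 E) (2 *: y).
Proof.
move=> i0i i0j ij Zy; set G := shear i j _ in Zy *.
(* [S] doubles [e0], so its determinant 2 compensates the determinant 1/2 of [G], and it acts
   trivially on [hull0 E]. *)
pose S : 'M[R]_n := 1%:M + e0^T *m e0.
have e0G : e0 *m G = e0.
  by rewrite mul_shear mxE (eq_sym j) (negbTE i0j) andbF mul0r scale0r addr0.
have Ge0 : G *m e0^T = e0^T.
  apply: trmx_inj; rewrite trmx_mul trmxK mul_shear_tr !mxE !(eq_sym _ i0).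
  by rewrite (negbTE i0i) (negbTE i0j) !andbF subrr mulr0 scale0r addr0.
have e0e0 : e0 *m e0^T = 1%:M.
  by rewrite [LHS]mx11_scalar -[(_ *m _) 0 0]/(dotv e0 e0) dotv_e0.
have EG : G *m E = E *m (S *m G).
  have -> : E *m (S *m G) = E *m G.
    rewrite mulmxA; congr (_ *m _).
    by rewrite mulmxDr mulmx1 mulmxA mulmxBl mul1mx -mulmxA e0e0 mulmx1 subrr mul0mx addr0.
  by rewrite mulmxBr mulmxBl mulmx1 mul1mx mulmxA Ge0 -mulmxA e0G.
have dSG : \det (S *m G) = 1.
  rewrite det_mulmx det_shear // det_add_rank1 -[(_ *m _) 0 0]/(dotv e0 e0) dotv_e0.
  by rewrite mulfV.
have e00 : e0 != 0 by rewrite -dotv_eq0 dotv_e0 oner_eq0.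
have [c yc] : exists c : R, y = c *: e0.
  apply: value_in_hyperplane Zy => //; first exact: hull0_polytope.
  have Ee0 : E *m e0^T = 0 by rewrite mulmxBl mul1mx -mulmxA e0e0 mulmx1 subrr.
  by move=> _ [w _ ->]; rewrite /hyperplane /= /dotv -!mulmxA Ee0 !mulmx0 mxE.
move: Zy; rewrite EG -hull0_mul Zcontra //=; last exact: hull0_polytope.
rewrite yc trmx_mul mulmxA -!scalemxAl.
have -> : e0 *m G^T = e0 by apply: trmx_inj; rewrite trmx_mul trmxK.
rewrite linearD /= trmx1 trmx_mul trmxK mulmxDr mulmx1 mulmxA e0e0 mul1mx.
by rewrite -mulr2n scalerA mulrC -scalerA scaler_nat.
Qed.

(** Each half has a value whose double lies in [Z (hull0 E)]; hence this convex set contains its own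
    double, and it is bounded. *)
Lemma value_standard_facet : Z (hull0 E) `<=` [set 0].
Proof.
have pE : polytope_o (hull0 E) by exact: hull0_polytope.
pose u : 'rV[R]_n := 2^-1 *: delta_mx 0 i1 - (1 - 2^-1) *: delta_mx 0 i2.
have half_lt1 : 0 < (2^-1 : R) < 1 by apply/andP; split; lra.
have dE l i : i0 != i -> dotv (row l E) (delta_mx 0 i) = (l == i)%:R.
  move=> i0i; rewrite row_E dotvZl dotv_delta mxE eqxx /=.
  have [->|li] := eqVneq l i; first by rewrite (eq_sym i) i0i mulr1.
  by rewrite mulr0.
have Eu l : dotv (row l E) u = 2^-1 * (l == i1)%:R - (1 - 2^-1) * (l == i2)%:R.
  by rewrite dotvDr dotvNr !dotvZr !dE.
have hu := hull0_shear i12 half_lt1 Eu.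
have Eu' l : dotv (row l E) (- u) = 2^-1 * (l == i2)%:R - (1 - 2^-1) * (l == i1)%:R.
  by rewrite dotvNr Eu; lra.
have i21 : i2 != i1 by rewrite eq_sym.
have hu' := hull0_shear i21 half_lt1 Eu'.
have dbl : Z (hull0 E) `<=` [set y | Z (hull0 E) (2 *: y)].
  apply: (@value_cut_le _ u) => //.
  - move=> x y t /= Zx Zy t01; rewrite scalerDr !scalerA !(mulrC 2) -!scalerA.
    exact: value_convex.
  - by move=> y; rewrite /half hu => /value_standard_half; apply.
  - by move=> y; rewrite /half hu' => /value_standard_half; apply.
have dblk k y : Z (hull0 E) y -> Z (hull0 E) (2 ^+ k *: y).
  by elim: k y => [|k IH] y Zy; rewrite ?expr0 ?scale1r // exprS -scalerA; apply: dbl; exact: IH.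
move=> y Zy; apply/eqP; rewrite -dotv_eq0; apply/eqP.
have [b Zb] := value_bounded y pE.
apply: (@exp2_bounded_eq0 _ _ b) => k.
by have := Zb _ (dblk k y Zy); rewrite dotvZl normrM ger0_norm // exprn_ge0.
Qed.

End StandardFacet.

(** Adding a normal vector to [W], rescaled to determinant 1, yields a unimodular map from the
    standard facet; the added row meets the zero row of [E] and leaves no trace. *)
Lemma value_facet_simplex (W : 'M[R]_(m.+2, n)) : row_free W -> Z (hull0 W) `<=` [set 0].
Proof.
move=> fW; have [|u u0 Wu] := @exists_annihilator R n _ W.
  by rewrite (eqP fW).
pose U : 'M[R]_(1 + m.+2) := col_mx u W.
have fU : row_free U.
  apply: inj_row_free => w; rewrite -[w]hsubmxK mul_row_col [lsubmx w]mx11_scalar mul_scalar_mx.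
  move=> w0; have l0 : lsubmx w 0 0 = 0.
    have := congr1 (dotv u) w0; rewrite dotv0r dotvDr dotvZr [dotv u (_ *m W)]dotvC dotv_mull.
    rewrite -[u *m W^T]trmxK trmx_mul trmxK Wu trmx0 dotv0r addr0 => /eqP.
    by rewrite mulf_eq0 dotv_eq0 (negbTE u0) orbF => /eqP.
  move: w0; rewrite l0 scale0r add0r => w0.
  have -> : rsubmx w = 0 by apply: (row_free_inj fW); rewrite mul0mx.
  by rewrite raddf0 row_mx0.
have dU : \det U != 0 by move: fU; rewrite row_free_unit unitmxE unitfE.
pose M : 'M[R]_(1 + m.+2) := col_mx ((\det U)^-1 *: u) W.
have dM : \det M = 1.
  have -> : M = block_mx ((\det U)^-1)%:M 0 0 1%:M *m U.
    by rewrite mul_block_col !mul_scalar_mx !mul0mx scale1r addr0 add0r.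
  by rewrite det_mulmx det_ublock det1 mulr1 det_scalar1 mulVf.
pose e0 : 'rV[R]_n := delta_mx 0 ord0.
pose E : 'M[R]_n := 1%:M - e0^T *m e0.
have rowE l : row l (E *m M) = (l != ord0)%:R *: row l M.
  by rewrite row_mul row_E -scalemxAl -rowE.
have M0 l : row (rshift 1 l) M = row l W by rewrite rowKd.
have WE : hull0 W = [set x *m M | x in hull0 E].
  rewrite hull0_mul; apply/seteqP; split; apply: hull0_sub => l.
    by rewrite -M0 -[row _ M]scale1r -[1]/((rshift 1 l != ord0 :> 'I_n)%:R) -rowE; exact: hull0_row.
  rewrite rowE; case: (@split_ordP 1 m.+2 l) => j ->.
    by rewrite (_ : lshift _ j = ord0) ?eqxx ?scale0r; [exact: hull0_0|apply: val_inj; rewrite /= ord1].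
  by rewrite M0 scale1r; exact: hull0_row.
rewrite WE Zcontra //; last exact: hull0_polytope.
move=> y /= Zy; have : y *m M^T = 0.
  apply: (@value_standard_facet ord0 (inord 1) (inord 2) _ _ _ _ Zy);
  by rewrite -val_eqE /= ?inordK.
have uM : M^T \in unitmx by rewrite unitmx_tr unitmxE dM unitr1.
by move/(congr1 (fun z => z *m invmx M^T)); rewrite mulmxK // mul0mx.
Qed.

(** If [P] has rank n - 1, it is dissected into pieces of (n-1)-simplices, whose values are trivial.
    Degenerate pieces, and [P] itself when its rank is smaller, lie in a second independent
    hyperplane. *)
Lemma value_hyperplane P u : polytope_o P -> u != 0 -> P `<=` hyperplane u -> Z P `<=` [set 0].
Proof.
move=> pP u0 Pu; have [k [V PV]] := polytope_hull0 pP.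
have Vu : V *m u^T = 0.
  apply/colP => i; rewrite [RHS]mxE -dotv_row_mul; apply: Pu; rewrite PV; exact: hull0_row.
have nonmult v : dotv v u = 0 -> v != 0 -> forall c : R, v != c *: u.
  move=> vu v0 c; apply/eqP => vc; move: v0; rewrite -dotv_eq0 {2}vc dotvZr vu mulr0 eqxx.
  by [].
have : (\rank V <= m.+2)%N.
  by have := mulmx0_rank_max Vu; rewrite mxrank_tr rank_rV u0 addn1.
rewrite leq_eqVlt => /orP[/eqP rV|rV]; last first.
  have [|v v0 Nv] := @exists_annihilator R n _ (col_mx V u).
    rewrite -addsmxE; apply: leq_ltn_trans (mxrank_adds_leqif V u) _.
    by rewrite rank_rV u0 addn1.
  have /eq_col_mx[Vv uv] : col_mx (V *m v^T) (u *m v^T) = col_mx 0 0.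
    by rewrite -mul_col_mx Nv col_mx0.
  have vu : dotv v u = 0 by rewrite dotvC /dotv uv mxE.
  apply: (@value_codim2 P u v) => //; first exact: nonmult.
  by move=> x; rewrite PV => -[w _ ->]; rewrite /hyperplane /= /dotv -mulmxA Vv mulmx0 mxE.
have [L Lref] := simplicial_refinement rV isT.
have codim2 (Q : set 'rV[R]_n) l : polytope_o Q -> Q `<=` P -> Q `<=` hyperplane l ->
    (exists2 x, P x & dotv x l != 0) -> Z Q `<=` [set 0].
  move=> pQ QP Ql [x Px xl]; apply: (@value_codim2 Q u l) => // [c|y /QP/Pu //].
  by apply/eqP => lc; move: xl; rewrite lc dotvZr (Pu _ Px) mulr0 eqxx.
apply: (@value_pieces_le L _ P) => // [x y t -> -> _|L' /Lref].
  by rewrite !scaler0 addr0.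
rewrite -PV => -[[l nvl Ql]|[f ff [_ Qf]]].
  apply: (@codim2 _ l) => //; first exact: polytope_dual_cone.
  by move=> x [Px Lx]; exact: Ql.
rewrite Qf; apply: subset_trans (value_facet_simplex ff).
pose D (Q : set 'rV[R]_n) := Q `<=` hyperplane u.
apply: (@value_piece_ge D); first by move=> Q v _ DQ x [/DQ].
- move=> Q v pQ DQ.
  have [Qv|/existsNP[x /not_implyP[Qx /eqP xv]]] := pselect (forall x, Q x -> dotv x v = 0); first by left.
  right; apply: (@value_codim2 _ u v) => //; [exact: polytope_hyperplane| |by move=> z [/DQ]].
  by move=> c; apply/eqP => vc; move: xv; rewrite vc dotvZr (DQ _ Qx) mulr0 eqxx.
- exact: hull0_polytope.
- have fP : hull0 (rowsub f V) `<=` P.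
    by rewrite PV; apply: hull0_sub => j; rewrite row_rowsub; exact: hull0_row.
  exact: subset_trans fP Pu.
Qed.

Lemma value_piece L P : polytope_o P -> Z (P `&` dual_cone L) `<=` Z P.
Proof.
move=> pP; apply: (@value_piece_ge (fun=> True)) => // Q u pQ _.
have [->|u0] := eqVneq u 0; first by left=> x _; rewrite /hyperplane /= dotv0r.
by right; apply: (@value_hyperplane _ u) => //; exact: polytope_hyperplane.
Qed.

(* [s Z(s T)] for the standard simplex [T]; it turns out not to depend on [s]. *)
Definition dilate_value (s : R) : set 'rV[R]_n :=
  [set y | Z (hull0 s%:M) (s^-1 *: y)].

(** The matrix [A] is split into the dilation by [r] and the unimodular [r^-1 A]; contravariance
    handles the latter. *)
Lemma dilate_value_mul (s r : R) (A : 'M[R]_n) y : 0 < s -> 0 < r -> r ^+ n = \det A ->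
  Z (hull0 (s *: A)) (s^-1 *: y) <-> dilate_value (s * r) (y *m A^T).
Proof.
move=> s0 r0 rA; have rn0 : r != 0 by rewrite gt_eqF.
have -> : s *: A = (s * r)%:M *m (r^-1 *: A).
  by rewrite mul_scalar_mx scalerA mulfK.
rewrite -hull0_mul Zcontra; last 2 first.
- exact: hull0_polytope.
- by rewrite detZ -rA exprVn mulVf // expf_neq0.
rewrite /dilate_value /= -!scalemxAl linearZ /= -scalemxAr scalerA -invfM mulrC.
by [].
Qed.

Lemma dilate_value_convex s : convex_set (dilate_value s).
Proof.
move=> x y t Kx Ky t01; rewrite /dilate_value /= scalerDr !scalerA !(mulrC s^-1) -!scalerA.
by apply: value_convex => //; exact: hull0_polytope.
Qed.

Lemma dotv_row_scalar (i j : 'I_n) (t s : R) (l : 'I_n) : s != 0 ->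
  dotv (row l (s%:M : 'M[R]_n)) (s^-1 *: (t *: delta_mx 0 i - (1 - t) *: delta_mx 0 j)) =
  t * (l == i)%:R - (1 - t) * (l == j)%:R.
Proof.
move=> s0; have -> : row l (s%:M : 'M[R]_n) = s *: delta_mx 0 l.
  by rewrite -scalemx1 linearZ /= row1.
rewrite dotvZl dotvZr mulrA mulfV // mul1r dotvDr dotvNr !dotvZr !dotv_delta !mxE !eqxx /=.
by rewrite !(eq_sym l).
Qed.

(** * Cutting dilates of the standard simplex across an edge *)

Section Shearing.
Variables (i j : 'I_n) (t s r r' : R).
Hypotheses (ij : i != j) (t01 : 0 < t < 1) (s0 : 0 < s).
Hypotheses (r0 : 0 < r) (rt : r ^+ n = t) (r'0 : 0 < r') (r't : r' ^+ n = 1 - t).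
Let u : 'rV[R]_n := s^-1 *: (t *: delta_mx 0 i - (1 - t) *: delta_mx 0 j).

Lemma hull0_scalar_half : hull0 s%:M `&` half u = hull0 (s *: shear i j t).
Proof.
rewrite /half (hull0_shear ij t01) ?mul_mx_scalar // => l.
by rewrite dotv_row_scalar // gt_eqF.
Qed.

Lemma hull0_scalar_halfN : hull0 s%:M `&` half (- u) = hull0 (s *: shear j i (1 - t)).
Proof.
rewrite /half (@hull0_shear _ _ _ s%:M j i (1 - t) (- u)) ?mul_mx_scalar //.
- by rewrite eq_sym.
- by case/andP: t01 => *; apply/andP; split; lra.
- by move=> l; rewrite dotvNr dotv_row_scalar; [ring|rewrite gt_eqF].
Qed.

(** The half is [s] times a shear of determinant [t = r^n], so its value is a sheared copy of the
    one at scale [s * r]; [value_piece] then compares it with the whole. *)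
Lemma dilate_value_ge y : dilate_value (s * r) (y *m (shear i j t)^T) -> dilate_value s y.
Proof.
rewrite -dilate_value_mul ?det_shear // -hull0_scalar_half => Zy.
have pT : polytope_o (hull0 (s%:M : 'M[R]_n)) by exact: hull0_polytope.
apply: (@value_piece [:: u]) => //; rewrite dual_cone_cons dual_cone_nil; exact: Zy.
Qed.

Lemma dilate_value_le M : convex_set M ->
  (forall y, dilate_value (s * r) (y *m (shear i j t)^T) -> M y) ->
  (forall y, dilate_value (s * r') (y *m (shear j i (1 - t))^T) -> M y) ->
  dilate_value s `<=` M.
Proof.
move=> cM h h' y Zy; have pT : polytope_o (hull0 (s%:M : 'M[R]_n)) by exact: hull0_polytope.
pose M' := [set z | M (s *: z)].
have MM' z : M (s *: (s^-1 *: z)) -> M z by rewrite scalerA mulfV ?scale1r // gt_eqF.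
apply: MM'; apply: (@value_cut_le _ u M' pT) Zy.
- by move=> a b q Ma Mb q01; rewrite /M' /= scalerDr !scalerA !(mulrC s) -!scalerA; exact: cM.
- move=> z; rewrite hull0_scalar_half => Zz; apply: h.
  by rewrite -dilate_value_mul ?det_shear // scalerA mulVf ?scale1r // gt_eqF.
- move=> z; rewrite hull0_scalar_halfN => Zz; apply: h'.
  by rewrite -dilate_value_mul ?det_shear // 1?eq_sym // scalerA mulVf ?scale1r // gt_eqF.
Qed.

End Shearing.

Lemma exists_two_others (l : 'I_n) : exists i j : 'I_n, [/\ i != j, i != l & j != l].
Proof.
have : (1 < #|predC1 l|)%N by rewrite cardC1 card_ord.
by move/card_gt1P => [i [j [il jl ij]]]; exists i, j.
Qed.

(** * Dilated values lie on the diagonal and do not depend on the scale *)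

Section HalvingRatio.
Variable q : R.
Hypotheses (q0 : 0 < q) (qn : q ^+ n = 2^-1).

Let half01 : 0 < (2^-1 : R) < 1. Proof. by apply/andP; split; lra. Qed.
Let qn' : q ^+ n = 1 - 2^-1. Proof. rewrite qn; lra. Qed.

(** In dimension at least 3 the edge can be chosen away from the direction [l]; the shears then
    leave coordinate [l] unchanged. *)
Lemma dilate_value_box s b : 0 < s ->
  (forall y l, dilate_value (s * q) y -> `|y 0 l| <= b) ->
  forall y l, dilate_value s y -> `|y 0 l| <= b.
Proof.
move=> s0 h y l; have [i [j [ij il jl]]] := exists_two_others l.
have cM : convex_set [set y : 'rV[R]_n | `|y 0 l| <= b].
  move=> x z t /= xb zb /andP[t0 t1]; rewrite !mxE; apply: le_trans (ler_normD _ _) _.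
  rewrite !normrM (ger0_norm t0) ger0_norm ?subr_ge0 //.
  have -> : b = (1 - t) * b + t * b by ring.
  by rewrite lerD // ler_wpM2l // subr_ge0.
move: y; apply: (@dilate_value_le i j 2^-1 s q q) => // y /h => /(_ l);
  by rewrite mul_shear_tr !mxE !eqxx /= eq_sym ?(negbTE jl) ?(negbTE il) mulr0 addr0.
Qed.

(** Passing from [s] to [s / q] doubles [y_i - y_j], while the bound [b] on the coordinates persists
    by [dilate_value_box]. *)
Lemma dilate_value_difference k s b y (i j : 'I_n) : i != j -> 0 < s ->
  (forall y l, dilate_value s y -> `|y 0 l| <= b) ->
  dilate_value s y -> 2 ^+ k * `|y 0 i - y 0 j| <= 2 * b.
Proof.
move=> ij; elim: k s y => [|k IH] s y s0 h Ky.
  have := ler_normB (y 0 i) (y 0 j); have := h _ i Ky; have := h _ j Ky.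
  rewrite expr0 mul1r; lra.
have sq0 : 0 < s / q by exact: divr_gt0.
have sq : s / q * q = s by rewrite divfK // gt_eqF.
(* The preimage of [y] under the transposed shear with ratio 1/2. *)
pose y' : 'rV[R]_n := y - (y 0 i - y 0 j) *: delta_mx 0 j.
have ji : (i == j) = false by exact/negbTE.
have y'i : y' 0 i = y 0 i by rewrite !mxE eqxx ji /= mulr0 subr0.
have y'j : y' 0 j = 2 * y 0 j - y 0 i by rewrite !mxE !eqxx /= mulr1; ring.
have Ky' : dilate_value (s / q) y'.
  apply: (@dilate_value_ge i j 2^-1 _ q) => //; rewrite sq mul_shear_tr y'i y'j.
  rewrite /y' -addrA -scaleNr -scalerDl.
  have -> : - (y 0 i - y 0 j) + (1 - 2^-1) * (y 0 i - (2 * y 0 j - y 0 i)) = 0 by field.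
  by rewrite scale0r addr0.
have box' : forall z l, dilate_value (s / q) z -> `|z 0 l| <= b.
  by apply: (dilate_value_box sq0); rewrite sq.
have := IH _ _ sq0 box' Ky'; rewrite y'i y'j.
have -> : y 0 i - (2 * y 0 j - y 0 i) = 2 * (y 0 i - y 0 j) by ring.
by rewrite normrM ger0_norm // mulrA -exprSr.
Qed.

Lemma dilate_value_bounded s : 0 < s ->
  exists b, forall y l, dilate_value s y -> `|y 0 l| <= b.
Proof.
move=> s0; have pT : polytope_o (hull0 (s%:M : 'M[R]_n)) by exact: hull0_polytope.
have [B hB] := choice (fun l : 'I_n => value_bounded (delta_mx 0 l) pT).
exists (\sum_l s * `|B l|) => y l Ky; rewrite (bigD1 l) //=.
have := hB l _ Ky; rewrite dotv_delta mxE normrM gtr0_norm ?invr_gt0 // mulrC ler_pdivrMr // => yB.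
have h0 : 0 <= \sum_(i | i != l) s * `|B i| by apply: sumr_ge0 => i _; rewrite mulr_ge0 // ltW.
have := ler_wpM2r (ltW s0) (ler_norm (B l)); lra.
Qed.

Lemma dilate_value_diagonal s y (i j : 'I_n) : 0 < s -> dilate_value s y -> y 0 i = y 0 j.
Proof.
move=> s0 Ky; have [->//|ij] := eqVneq i j.
have [b bK] := dilate_value_bounded s0.
apply/eqP; rewrite -subr_eq0; apply/eqP; apply: (@exp2_bounded_eq0 _ _ (2 * b)) => k.
exact: (dilate_value_difference _ ij s0 bK Ky).
Qed.

(** Transposed shears fix diagonal points, so both halves contribute the same set, that of scale
    [s * q]. *)
Lemma dilate_value_halve s : 0 < s -> dilate_value s `<=` dilate_value (s * q).
Proof.
move=> s0; have sq0 : 0 < s * q by exact: mulr_gt0.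
have fix_shear (i j : 'I_n) y : i != j -> dilate_value (s * q) (y *m (shear i j (2^-1))^T) ->
    dilate_value (s * q) y.
  move=> ij Ky; have := dilate_value_diagonal i j sq0 Ky; move: Ky.
  rewrite mul_shear_tr => Ky; rewrite !mxE !eqxx (negbTE ij) /= mulr0 mulr1 addr0 => yij.
  have yij' : y 0 i - y 0 j = 0 by lra.
  by rewrite yij' mulr0 scale0r addr0 in Ky.
have ij : (ord0 : 'I_n) != lift ord0 ord0 by [].
apply: (@dilate_value_le ord0 (lift ord0 ord0) 2^-1 s q q) => //.
- exact: dilate_value_convex.
- by move=> y; exact: fix_shear.
- move=> y; rewrite (_ : 1 - 2^-1 = 2^-1 :> R); last by lra.
  by apply: fix_shear; rewrite eq_sym.
Qed.

Lemma dilate_value_shrink s t : 0 < s -> 0 < t < 1 -> dilate_value (s * t) `<=` dilate_value s.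
Proof.
move=> s0 /andP[t0 t1] y Ky; have ij : (ord0 : 'I_n) != lift ord0 ord0 by [].
have st0 : 0 < s * t by exact: mulr_gt0.
apply: (@dilate_value_ge ord0 (lift ord0 ord0) (t ^+ n) _ t) => //.
  by rewrite exprn_gt0 // exprn_ilt1 // ltW.
rewrite mul_shear_tr (dilate_value_diagonal ord0 (lift ord0 ord0) st0 Ky).
by rewrite subrr mulr0 scale0r addr0.
Qed.

(** Repeated halving carries the value to a scale below [s'], from which [dilate_value_shrink]
    returns to [s']. *)
Lemma dilate_value_sub s s' : 0 < s -> 0 < s' -> dilate_value s `<=` dilate_value s'.
Proof.
move=> s0 s'0; have iter k : dilate_value s `<=` dilate_value (s * q ^+ k).
  elim: k => [|k IH]; first by rewrite expr0 mulr1.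
  apply: subset_trans IH _; rewrite exprSr mulrA; apply: dilate_value_halve.
  by rewrite mulr_gt0 // exprn_gt0.
have [k ks] : exists k, s * q ^+ k < s'.
  (* The exponent [n * k] turns the power of [q] into [2^-k]. *)
  have [k hk] := exists_exp2_gt (s / s'); exists (n * k)%N.
  by rewrite exprM qn exprVn ltr_pdivrMr ?exprn_gt0 // mulrC -ltr_pdivrMr.
apply: subset_trans (iter k) _.
have e : s * q ^+ k = s' * (s * q ^+ k / s') by rewrite [RHS]mulrC divfK // gt_eqF.
rewrite e; apply: dilate_value_shrink => //.
by rewrite ltr_pdivrMr // mul1r ks divr_gt0 // mulr_gt0 // exprn_gt0.
Qed.

End HalvingRatio.

Lemma dilate_value_eq s s' : 0 < s -> 0 < s' -> dilate_value s = dilate_value s'.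
Proof.
have half0 : 0 < (2^-1 : R) by lra.
have [q q0 qn] := @exists_root R n _ isT half0.
by move=> s0 s'0; apply/seteqP; split; apply: (dilate_value_sub q0 qn).
Qed.

(** A compact convex subset of the diagonal containing o is a segment; [c1] and [- c2] are its
    extreme coordinates. *)
Lemma value_standard_simplex : exists c1 c2 : R, [/\ 0 <= c1, 0 <= c2 &
  forall y, Z (hull0 1%:M) y <-> exists2 d, - c2 <= d <= c1 & y = d *: const_mx 1].
Proof.
have half0 : 0 < (2^-1 : R) by lra.
have [q q0 qn] := @exists_root R n _ isT half0.
have pT : polytope_o (hull0 (1%:M : 'M[R]_n)) by exact: hull0_polytope.
set K := Z (hull0 1%:M).
have diag y : K y -> y = y 0 ord0 *: const_mx 1.
  move=> Ky; apply/rowP => l; rewrite !mxE mulr1.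
  apply: (dilate_value_diagonal q0 qn l ord0 ltr01).
  by rewrite /dilate_value /= invr1 scale1r.
have K0 : K 0 by exact: value0.
have cK : compact K by case: (Zbody pT).
have nK : K !=set0 by exists 0.
have [a Ka amax] := compact_dotv_max (delta_mx 0 ord0) cK nK.
have [b Kb bmax] := compact_dotv_max (- delta_mx 0 ord0) cK nK.
rewrite dotv_delta in amax; rewrite dotvNr dotv_delta in bmax.
have bmin y : K y -> b 0 ord0 <= y 0 ord0.
  by move=> /bmax; rewrite dotvNr dotv_delta lerN2.
exists (a 0 ord0), (- b 0 ord0); split=> [||y].
- by have := amax _ K0; rewrite dotv0l.
- by have := bmin _ K0; rewrite [X in _ <= X]mxE oppr_ge0.
rewrite opprK; split=> [Ky|[d /andP[bd da] ->]].
  by exists (y 0 ord0); rewrite -?diag // bmin //= -dotv_delta amax.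
have [ab|ab] := eqVneq (a 0 ord0) (b 0 ord0).
  have -> : d = a 0 ord0 by apply/eqP; rewrite eq_le da ab bd.
  by rewrite -diag.
have ab0 : 0 < a 0 ord0 - b 0 ord0 by rewrite subr_gt0 lt_neqAle eq_sym ab (le_trans bd).
pose t := (d - b 0 ord0) / (a 0 ord0 - b 0 ord0).
have -> : d *: const_mx 1 = (1 - t) *: b + t *: a.
  rewrite (diag _ Kb) (diag _ Ka) !scalerA -scalerDl; congr (_ *: _).
  by rewrite /t; field; rewrite gt_eqF.
apply: value_convex => //; rewrite ler_pdivrMr // mul1r lerD2r da andbT.
by rewrite divr_ge0 ?subr_ge0 // ltW // -subr_gt0.
Qed.

(** * Values at arbitrary simplices and the classification *)

Lemma value_simplex (c1 c2 : R) :
  (forall y, Z (hull0 1%:M) y <-> exists2 d, - c2 <= d <= c1 & y = d *: const_mx 1) ->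
  forall (W : 'M[R]_n) a, W \in unitmx -> (forall i, dotv (row i W) a = 1) ->
  forall y, Z (hull0 W) y <-> exists2 d, - c2 <= d <= c1 & y = d *: a.
Proof.
move=> ZT; suff pos (W : 'M[R]_n) a : 0 < \det W -> (forall i, dotv (row i W) a = 1) ->
    forall y, Z (hull0 W) y <-> exists2 d, - c2 <= d <= c1 & y = d *: a.
  move=> W a uW Wa; have [|dW] := ltP 0 (\det W); first by move/pos; apply.
  (* Exchanging two rows makes the determinant positive and leaves the hull unchanged. *)
  pose W' := xrow ord0 (lift ord0 ord0) W.
  have rowW' i : row i W' = row (tperm ord0 (lift ord0 ord0) i) W.
    by apply/rowP => l; rewrite !mxE.
  have -> : hull0 W = hull0 W'.
    apply/seteqP; split; apply: hull0_sub => i; last by rewrite rowW'; exact: hull0_row.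
    by rewrite -[i](tpermK ord0 (lift ord0 ord0)) -rowW'; exact: hull0_row.
  apply: pos => [|i]; last by rewrite rowW'.
  rewrite /W' xrowE det_mulmx det_perm odd_tperm /= expr1 mulN1r oppr_gt0.
  by rewrite lt_neqAle dW andbT -unitfE -unitmxE.
move=> dW Wa y; have uW : W^T \in unitmx by rewrite unitmx_tr unitmxE unitfE gt_eqF.
have aW : a *m W^T = const_mx 1.
  apply: trmx_inj; rewrite trmx_mul trmxK; apply/colP => i.
  by rewrite -dotv_row_mul Wa !mxE.
(* Up to a unimodular map the simplex is the standard one dilated by [r]; the scale drops out, and
   the all-ones vector, dual of the standard simplex, corresponds to [a]. *)
have [r r0 rn] := @exists_root R n _ isT dW.
have := dilate_value_mul y ltr01 r0 rn; rewrite scale1r invr1 scale1r mul1r.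
rewrite (dilate_value_eq r0 ltr01) /dilate_value /= invr1 scale1r => h.
rewrite h ZT; split=> -[d d12 yd]; exists d => //; last by rewrite yd -scalemxAl aW.
by apply: (can_inj (mulmxK uW)); rewrite yd -scalemxAl aW.
Qed.

(** The cone makes the coordinates with respect to [W] nonnegative, and their sum [x . a] is at most
    1 on [P]. So the simplex is a piece of [P], and its value is contained in [Z P]. *)
Lemma hull0_dual_cone P (W : 'M[R]_n) a : polytope_o P -> W \in unitmx ->
  (forall x, P x -> dotv x a <= 1) -> (forall i, P (row i W) /\ dotv (row i W) a = 1) ->
  hull0 W = P `&` dual_cone [seq row i (invmx W)^T | i <- enum 'I_n].
Proof.
move=> pP uW Pa PW.
have coordE x i : dotv x (row i (invmx W)^T) = (x *m invmx W) 0 i.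
  by rewrite dotvC dotv_row_mul -trmx_mul mxE.
have sumE w : dotv (w *m W) a = \sum_i w 0 i.
  by rewrite lincomb_row dotv_suml; apply: eq_bigr => i _; rewrite dotvZl (PW i).2 mulr1.
apply/seteqP; split=> x.
  move=> Wx; split.
    move: Wx; apply: hull0_min; [exact: polytope_convex|by case: pP|by move=> i; case: (PW i)].
  case: Wx => w [w0 _] -> _ /mapP[i _ ->]; by rewrite coordE mulmxK.
move=> [Px Lx]; exists (x *m invmx W); last by rewrite mulmxKV.
split=> [i|]; last by rewrite -sumE mulmxKV // Pa.
by rewrite -coordE; apply: Lx; apply/mapP; exists i; rewrite ?mem_enum.
Qed.

Lemma valuation_classification : exists c1 c2 : R, 0 <= c1 /\ 0 <= c2 /\
  forall P, polytope_o P -> Z P = conv (spokes c1 c2 (facet_duals P)).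
Proof.
have [c1 [c2 [c10 c20 ZT]]] := value_standard_simplex.
exists c1, c2; split=> //; split=> // P pP; set S := conv _.
have cS : convex_set S by exact: conv_convex.
have S0 : S 0 by apply: sub_conv; left.
apply/seteqP; split; last first.
  apply: conv_min; first exact: value_convex.
  move=> x [->|[a [Pa [W uW PW]] xa]]; first exact: value0.
  apply: (@value_piece [seq row i (invmx W)^T | i <- enum 'I_n]) => //.
  rewrite -(hull0_dual_cone pP uW Pa PW).
  apply/(value_simplex ZT uW (fun i => (PW i).2)).
  case: xa => ->; [exists c1|exists (- c2)]; rewrite ?scaleNr ?lexx ?andbT //; lra.
have [k [V PV]] := polytope_hull0 pP.
have [rV|rV] := eqVneq (\rank V) n; last first.
  have [|u u0 Vu] := @exists_annihilator R n _ V.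
    by rewrite ltn_neqAle rV rank_leq_col.
  have Pu : P `<=` hyperplane u.
    by rewrite PV => _ [w _ ->]; rewrite /hyperplane /= /dotv -mulmxA Vu mulmx0 mxE.
  by move=> y /(value_hyperplane pP u0 Pu) ->.
have [L Lref] := simplicial_refinement rV isT.
apply: (@value_pieces_le L S P) => // L' /Lref; rewrite -PV.
case=> [[l [x Px xl] Ql]|[f ff [[a fa Pa] Qf]]].
  have l0 : l != 0 by apply: contraNneq xl => ->; rewrite dotv0r.
  apply: subset_trans (@value_hyperplane _ l _ l0 _) _; first exact: polytope_dual_cone.
    by move=> y [Py Ly]; exact: Ql.
  by move=> y ->.
have uf : rowsub f V \in unitmx by rewrite -row_free_unit.
have fa' i : dotv (row i (rowsub f V)) a = 1 by rewrite row_rowsub.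
have Fa : facet_duals P a.
  split=> //; exists (rowsub f V) => // i; split=> //; rewrite row_rowsub PV; exact: hull0_row.
rewrite Qf => y /(value_piece (hull0_polytope _)).
move/(value_simplex ZT uf fa') => [d /andP[d2 d1] ->].
have Sa : S (c1 *: a) by apply: sub_conv; right; exists a => //; left.
have Sa' : S (- (c2 *: a)) by apply: sub_conv; right; exists a => //; right.
(* The whole segment between [- c2 a] and [c1 a] follows from its endpoints and o, one side at a
   time. *)
have scaled x (c e : R) : S (c *: x) -> 0 <= e <= c -> S (e *: x).
  move=> Sx /andP[e0 ec]; have [c0|c0] := eqVneq c 0.
    by have -> : e = 0 by [apply/eqP; rewrite eq_le e0 -c0 ec]; rewrite scale0r.
  have cp : 0 < c by rewrite lt_neqAle eq_sym c0 (le_trans e0).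
  have -> : e *: x = (1 - e / c) *: 0 + (e / c) *: (c *: x).
    by rewrite scaler0 add0r scalerA divfK.
  by apply: cS => //; rewrite ler_pdivrMr // mul1r ec divr_ge0 // ltW.
have [d0|d0] := leP 0 d; first by apply: scaled Sa _; rewrite d0.
rewrite -[d]opprK scaleNr -scalerN; apply: (scaled _ c2); first by rewrite scalerN.
by rewrite oppr_ge0 ltW //= lerNl.
Qed.

End Valuation.

Theorem theorem1p3 (R : realType) (n : nat) (hn : (3 <= n)%N)
    (Z : set 'rV[R]_n -> set 'rV[R]_n)
    (hZ : forall P, polytope_o P -> body_o (Z P)) :
  (linf_valuation Z /\ SL_contravariant Z) <->
  (exists c1 c2 : R, 0 <= c1 /\ 0 <= c2 /\
     forall P, polytope_o P ->
       Z P = linf_sum (scale_set c1 (Pi_inf_plus P))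
                      (scale_set c2 (Pi_inf_minus P))).
Proof.
have n0 : (0 < n)%N by apply: leq_trans hn.
split=> [[Zval /SL_contravariantP Zcontra]|[c1 [c2 [_ [_ ZE]]]]].
  case: n hn n0 Z hZ Zval Zcontra => [|[|[|m]]] // _ n0 Z hZ Zval Zcontra.
  have [c1 [c2 [c10 [c20 ZE]]]] := valuation_classification hZ Zval Zcontra.
  exists c1, c2; split=> //; split=> // P pP.
  by rewrite ZE // projection_body_spokes.
split=> [K L pK pL pU pI|K phi pK dphi].
  by rewrite !ZE //; exact: projection_body_valuation.
have pimg : polytope_o (lin_img phi K) by exact: polytope_mul.
by rewrite !ZE //; exact: projection_body_contravariant.
Qed.
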